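(* For $d,n\in\mathbb{N}$ put $\alpha=\frac{n}{d}$ and $r=\frac{\sqrt{1+\alpha^2}-1}{\alpha}$. For all $d,n\in\mathbb{N}$ satisfying $n\le d$ we have $$D(d,n)=|B_n^d\cap\mathbb{Z}^d|\approx|S_n^d\cap\mathbb{Z}^d|\approx\Big(\frac{1+r}{1-r}\Big)^{d}r^{-n}\frac{1}{\sqrt n}.$$ In particular, in terms of $d$ and $n$, for $n\le d$, $$D(d,n)\approx\bigg(\frac{d}{\sqrt{d^2+n^2}-n}\bigg)^{d}\bigg(\frac{n}{\sqrt{d^2+n^2}-d}\bigg)^{n}\frac{1}{\sqrt n}.$$ Furthermore, there exists a function $$b(z)=\frac{z^2}{12}-\frac{3z^4}{160}+\sum_{k=3}^{\infty}b_kz^{2k},$$ holomorphic in the disk $\{z\in\mathbb{C}:|z|<2/3\}$, such that $$|B_n^d\cap\mathbb{Z}^d|\approx|S_n^d\cap\mathbb{Z}^d|\approx(2e/\alpha)^n\frac{1}{\sqrt n}\exp\big(n\,b(\alpha)\big)\qquad\text{for all } d,n\in\mathbb{N} \text{ with } n\le d/2,$$ $$|B_n^d\cap\mathbb{Z}^d|\approx(2e\alpha)^d\frac{1}{\sqrt d}\exp\big(d\,b(\alpha^{-1})\big)\qquad\text{for all } d,n\in\mathbb{N} \text{ with } n\ge 2d.$$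
   Context: $\mathbb{N}=\{1,2,\dots\}$. The Delannoy number $D(d,n)$ is the number of lattice paths from $(0,0)$ to $(d,n)$ using only single steps north $(0,1)$, northeast $(1,1)$, or east $(1,0)$. The closed cross-polytope ($\ell^1$ ball) and its boundary are $B_n^d=\{x\in\mathbb{R}^d:|x_1|+\dots+|x_d|\le n\}$ and $S_n^d=\{x\in\mathbb{R}^d:|x_1|+\dots+|x_d|=n\}$. For a finite set $A$, $|A|$ is its cardinality. For positive real quantities, $X\lesssim Y$ means $X\le CY$ with a universal (absolute) constant $C>0$ (independent of $d$ and $n$), and $X\approx Y$ means $X\lesssim Y$ and $Y\lesssim X$. *)

(* Defs.v *)
From HB Require Import structures.
From mathcomp Require Import all_boot all_order all_algebra finmap complex.
From mathcomp Require Import all_classical all_reals all_analysis.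

Set Implicit Arguments.
Unset Strict Implicit.
Unset Printing Implicit Defensive.

Import Order.TTheory GRing.Theory Num.Theory.
Import numFieldNormedType.Exports.

Local Open Scope classical_set_scope.
Local Open Scope ring_scope.

Definition unit_step (x y : nat * nat) : bool :=
  [|| y == (x.1, x.2.+1), y == (x.1.+1, x.2.+1) | y == (x.1.+1, x.2)].

(* A path is encoded by the list of the vertices visited after (0, 0).  This set
   of lists, like the sets of lattice points below, is finite, so [fset_set]
   does not take its default value. *)
Definition lattice_paths (d n : nat) : set (seq (nat * nat)) :=
  [set p | path unit_step (0%N, 0%N) p /\ last (0%N, 0%N) p = (d, n)].

Definition Delannoy (d n : nat) : nat := #|` fset_set (lattice_paths d n)|.

Section LatticePoints.
Variable R : realType.

Definition l1norm (d : nat) (x : 'rV[R]_d) : R := \sum_(i < d) `|x ord0 i|.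

Definition cross_polytope (d n : nat) : set 'rV[R]_d :=
  [set x | l1norm x <= n%:R].

Definition cross_polytope_boundary (d n : nat) : set 'rV[R]_d :=
  [set x | l1norm x = n%:R].

Definition integer_points (d : nat) : set 'rV[R]_d :=
  [set x | forall i, x ord0 i \is a Num.int].

Definition card_ball (d n : nat) : nat :=
  #|` fset_set (@cross_polytope d n `&` @integer_points d)|.

Definition card_sphere (d n : nat) : nat :=
  #|` fset_set (@cross_polytope_boundary d n `&` @integer_points d)|.

(* X <~ Y, with a constant uniform over all d, n >= 1 satisfying P. *)
Definition lesssim_on (P : nat -> nat -> bool) (X Y : nat -> nat -> R) : Prop :=
  exists2 C : R, 0 < C &
    forall d n : nat, (0 < d)%N -> (0 < n)%N -> P d n -> X d n <= C * Y d n.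

Definition approx_on (P : nat -> nat -> bool) (X Y : nat -> nat -> R) : Prop :=
  lesssim_on P X Y /\ lesssim_on P Y X.

Definition alpha (d n : nat) : R := n%:R / d%:R.

Definition rho (d n : nat) : R :=
  (Num.sqrt (1 + alpha d n ^+ 2) - 1) / alpha d n.

Local Open Scope complex_scope.

(* Holomorphy on an open set A: the increments and the difference quotients in
   [derivable] range over the scalar field R[i] of R[i]^o, so this is complex
   differentiability. *)
Definition holomorphic_on (A : set R[i]) (f : R[i] -> R[i]) : Prop :=
  forall z, A z -> derivable (f : R[i]^o -> R[i]^o) z 1.

End LatticePoints.

(* Main.v *)
(* Peeling off the last step of a path, or the first coordinate of a lattice
   point, shows that Delannoy paths and points of the ball are counted by the
   same recurrence D(d+1,n+1) = D(d,n+1) + D(d,n) + D(d+1,n).  The generating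
   function (1+z)^d / (1-z)^(d+1) satisfies first-order differential equations,
   which give the contiguity relation
     (n+1) D(d,n+1) + n D(d,n) = (d+1) D(d+1,n) + d D(d,n)
   and hence (n+1) D(d,n+1) = (2d+1) D(d,n) + n D(d,n-1).  For n <= d the former
   yields D(d,n-1) <= D(d-1,n), so the ball has at most twice as many points as
   the sphere.  The latter makes (n+1) D(d,n+1) / D(d,n) agree up to an additive
   constant with w_n = d + sqrt (d^2 + n^2), because w_n = 2d + n^2 / w_n and the
   recursion for the ratio contracts errors.  Since the relative error is O(1/d),
   n! D(d,n) is comparable to w_0 w_1 ... w_(n-1) for n <= d, and by monotonicity
   of w to exp of the integral of log w over [0,n], which is explicit: it is
   n log (2d) + d H(n/d) with H' = log ((1 + sqrt (1 + x^2)) / 2).  Stirling's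
   formula then gives the closed forms.
   Differentiating twice, H(x) = x b(x) where b(z) is the sum over k >= 1 of
   - c_k z^(2k) / (2k (2k+1)), and c_k are the Taylor coefficients of
   (1 + t)^(-1/2).  The case n >= 2d follows from the symmetry of D. *)
Require Import Defs.
From HB Require Import structures.
From mathcomp Require Import all_boot all_order all_algebra finmap complex.
From mathcomp Require Import all_classical all_reals all_analysis.
From mathcomp Require Import ring lra zify.

Set Implicit Arguments.
Unset Strict Implicit.
Unset Printing Implicit Defensive.

Import Order.TTheory GRing.Theory Num.Theory.
Import numFieldNormedType.Exports.
Import ComplexField.Normc.

Local Open Scope classical_set_scope.
Local Open Scope ring_scope.
Local Open Scope complex_scope.

(** * Delannoy paths and the three-term recurrence *)

Lemma card_fset_set_seq (T : choiceType) (A : set T) (s : seq T) :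
  uniq s -> (forall x, A x <-> x \in s) -> #|` fset_set A| = size s.
Proof.
move=> us As.
have -> : A = [set` [fset x in s]%fset].
  by apply/seteqP; split => x /=; rewrite inE => /As.
by rewrite set_fsetK card_fseq undup_id.
Qed.

(** Nesting the fixpoints makes the recurrence structural: calls at [d'] go through the outer one,
    the call at the same [d] through the inner one. *)
Fixpoint delannoy (d n : nat) {struct d} : nat :=
  match d with
  | 0 => 1
  | d'.+1 => (fix aux n := match n with
      | 0 => 1
      | n'.+1 => delannoy d' n'.+1 + delannoy d' n' + aux n'
      end) n
  end.

Lemma delannoyn0 d : delannoy d 0 = 1%N. Proof. by case: d. Qed.

Lemma delannoySS d n :
  delannoy d.+1 n.+1 = (delannoy d n.+1 + delannoy d n + delannoy d.+1 n)%N.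
Proof. by []. Qed.

Lemma delannoyC d n : delannoy d n = delannoy n d.
Proof.
elim: d n => [|d IHd] n; first by rewrite delannoyn0.
elim: n => [|n IHn]; first by rewrite delannoyn0.
by rewrite !delannoySS IHn !IHd; lia.
Qed.

(** Paths are grown at their last vertex. The start is not recorded, so the only path to the origin
    is the empty list. *)
Fixpoint delannoy_paths (d n : nat) {struct d} : seq (seq (nat * nat)) :=
  match d with
  | 0 => (fix aux n := match n with
      | 0 => [:: [::]]
      | n'.+1 => [seq rcons p (0%N, n'.+1) | p <- aux n']
      end) n
  | d'.+1 => (fix aux n := match n with
      | 0 => [seq rcons p (d'.+1, 0%N) | p <- delannoy_paths d' 0]
      | n'.+1 => [seq rcons p (d'.+1, n'.+1) |
                   p <- delannoy_paths d' n'.+1 ++ delannoy_paths d' n' ++ aux n']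
      end) n
  end.

Lemma delannoy_pathsSS d n :
  delannoy_paths d.+1 n.+1 = [seq rcons p (d.+1, n.+1) |
    p <- delannoy_paths d n.+1 ++ delannoy_paths d n ++ delannoy_paths d.+1 n].
Proof. by []. Qed.

Lemma size_delannoy_paths d n : size (delannoy_paths d n) = delannoy d n.
Proof.
elim: d n => [|d IHd] n; first by elim: n => //= n IHn; rewrite size_map.
elim: n => [|n IHn]; first by rewrite /= size_map IHd delannoyn0.
by rewrite delannoySS -IHn -!IHd delannoy_pathsSS size_map !size_cat addnA.
Qed.

Lemma mem_map_rcons (T : eqType) (s : seq (seq T)) (v w : T) p :
  (rcons p w \in [seq rcons q v | q <- s]) = (w == v) && (p \in s).
Proof.
apply/mapP/andP => [[q qs /rcons_inj[-> ->]] //|[/eqP -> ps]].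
by exists p.
Qed.

Lemma path_rcons_last (q : seq (nat * nat)) v w :
  path unit_step (0%N, 0%N) (rcons q v) &&
    (last (0%N, 0%N) (rcons q v) == w) =
  (v == w) &&
    (path unit_step (0%N, 0%N) q && unit_step (last (0%N, 0%N) q) w).
Proof.
by rewrite rcons_path last_rcons; case: eqVneq => [->|_]; rewrite ?andbT ?andbF.
Qed.

(** Removing the last vertex leaves a path ending at one of its predecessors: three in general, a
    single one on the axes. *)
Lemma mem_delannoy_paths d n p :
  (p \in delannoy_paths d n) =
  path unit_step (0%N, 0%N) p && (last (0%N, 0%N) p == (d, n)).
Proof.
elim: d n p => [|d IHd] n p.
  elim: n p => [|n IHn] p; case/lastP: p => [|q v] //=.
  - rewrite path_rcons_last inE -size_eq0 size_rcons /=.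
    by rewrite /unit_step !xpair_eqE /= !andbF.
  - by apply/mapP => -[[|? ?]].
  - rewrite path_rcons_last mem_map_rcons IHn; congr (_ && (_ && _)).
    by case: (last _ _) => a b; rewrite /unit_step !xpair_eqE /=; lia.
elim: n p => [|n IHn] p; case/lastP: p => [|q v].
- by apply/mapP => -[[|? ?]].
- rewrite path_rcons_last mem_map_rcons IHd; congr (_ && (_ && _)).
  by case: (last _ _) => a b; rewrite /unit_step !xpair_eqE /=; lia.
- by apply/mapP => -[[|? ?]].
- rewrite delannoy_pathsSS path_rcons_last mem_map_rcons !mem_cat !IHd IHn.
  rewrite -!andb_orr; congr (_ && (_ && _)).
  by case: (last _ _) => a b; rewrite /unit_step !xpair_eqE /=; lia.
Qed.

Lemma uniq_delannoy_paths d n : uniq (delannoy_paths d n).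
Proof.
elim: d n => [|d IHd] n.
  by elim: n => //= n IHn; rewrite map_inj_uniq // => ? ? /rcons_inj[].
elim: n => [|n IHn]; first by rewrite /= map_inj_uniq // => ? ? /rcons_inj[].
rewrite delannoy_pathsSS map_inj_uniq => [|? ? /rcons_inj[] //].
(* Lists with different endpoints share no path, so the three concatenated blocks are disjoint. *)
have disj d1 n1 d2 n2 : (d1, n1) != (d2, n2) ->
    ~~ has (mem (delannoy_paths d1 n1)) (delannoy_paths d2 n2).
  move=> neq; apply/hasPn => p; rewrite !inE !mem_delannoy_paths.
  by case/andP=> _ /eqP ->; rewrite eq_sym (negbTE neq) andbF.
rewrite !cat_uniq !IHd IHn has_cat negb_or !disj //= xpair_eqE; lia.
Qed.

Lemma DelannoyE d n : Delannoy d n = delannoy d n.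
Proof.
rewrite -size_delannoy_paths; apply: card_fset_set_seq.
  exact: uniq_delannoy_paths.
move=> p; rewrite mem_delannoy_paths; split => [[-> /eqP ->] //|].
by case/andP=> ? /eqP.
Qed.

(** * Lattice points of the ball and of the sphere *)

Section BallCount.
Variable R : realType.

Definition int_range (n : nat) : seq int :=
  [seq Posz i | i <- iota 0 n.+1] ++ [seq Negz i | i <- iota 0 n].

Lemma uniq_int_range n : uniq (int_range n).
Proof.
rewrite cat_uniq !map_inj_uniq ?iota_uniq //=; try by move=> ? ? [].
by rewrite andbT; apply/hasPn => x /mapP[i _ ->]; apply/mapP => -[].
Qed.

Lemma mem_int_range n (z : int) : (z \in int_range n) = (absz z <= n)%N.
Proof.
rewrite mem_cat; case: z => i.
  rewrite mem_map => [|? ? []//]; rewrite mem_iota /= add0n ltnS.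
  by case: (_ <= _)%N => //=; apply/mapP => -[].
rewrite orbC mem_map => [|? ? []//]; rewrite mem_iota /= add0n.
case: (_ < _)%N => //=; apply/mapP => -[] //.
Qed.

(** The natural subtraction does not truncate, because |z| <= n on [int_range n]. *)
Fixpoint ball_points (d n : nat) {struct d} : seq 'rV[R]_d :=
  match d with
  | 0 => [:: 0]
  | d'.+1 => [seq (row_mx (z%:~R%:M : 'rV[R]_1) y : 'rV[R]_(1 + d')) |
               z <- int_range n, y <- ball_points d' (n - absz z)]
  end.

(** Splitting off the first coordinates 0 and -1 leaves z >= 1 and z <= -2. Moving these one step
    towards 0 gives the ball of radius smaller by 1 in the same dimension, whence the Delannoy
    recurrence. *)
Lemma size_ball_points d n : size (ball_points d n) = delannoy d n.
Proof.
have sizeS k m : size (ball_points k.+1 m) =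
    (\sum_(i < m.+1) size (ball_points k (m - i)) +
     \sum_(i < m) size (ball_points k (m - i.+1)))%N.
  rewrite size_allpairs_dep map_cat sumn_cat -!map_comp !sumnE !big_map.
  rewrite -(big_mkord xpredT (fun i => size (ball_points k (m - i)))).
  rewrite -(big_mkord xpredT (fun i => size (ball_points k (m - i.+1)))).
  by rewrite /index_iota !subn0.
elim: d n => [|d IHd] n //; elim: n => [|n IHn].
  by rewrite sizeS big_ord1 big_ord0 IHd sub0n delannoyn0.
rewrite delannoySS -IHn sizeS (sizeS d n) big_ord_recl subn0 IHd.
rewrite (eq_bigr (fun i : 'I__ => size (ball_points d (n - i)))) //.
rewrite [X in (_ + X)%N](eq_bigr
  (fun i : 'I__ => size (ball_points d (n - i)))) //.
rewrite [X in (_ + X = _)%N]big_ord_recl subn0 IHd.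
rewrite [X in (_ + (_ + X) = _)%N](eq_bigr
  (fun i : 'I__ => size (ball_points d (n - i.+1)))) //.
by rewrite addnACA.
Qed.

Lemma l1norm_row_mx d (x : R) (y : 'rV[R]_d) :
  l1norm (row_mx (x%:M : 'rV[R]_1) y : 'rV[R]_(1 + d)) = `|x| + l1norm y.
Proof.
rewrite /l1norm big_split_ord /= big_ord1; congr (`|_| + _).
  by rewrite row_mxEl mxE eqxx mulr1n.
by apply: eq_bigr => i _; rewrite row_mxEr.
Qed.

Lemma integer_points_row_mx d (x : R) (y : 'rV[R]_d) :
  integer_points (row_mx (x%:M : 'rV[R]_1) y : 'rV[R]_(1 + d)) <->
  x \is a Num.int /\ integer_points y.
Proof.
split => [int_xy|[int_x int_y] i].
  split=> [|i]; last by have := int_xy (rshift 1 i); rewrite row_mxEr.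
  by have := int_xy (lshift d ord0); rewrite row_mxEl mxE eqxx mulr1n.
rewrite -(splitK i); case: fintype.split => j /=; last by rewrite row_mxEr.
by rewrite row_mxEl mxE (ord1 j) eqxx mulr1n.
Qed.

Lemma l1norm_ge0 d (x : 'rV[R]_d) : 0 <= l1norm x.
Proof. exact: sumr_ge0. Qed.

Lemma mem_ball_points d n (x : 'rV[R]_d) :
  (cross_polytope n `&` integer_points (d := d)) x <-> x \in ball_points d n.
Proof.
elim: d n x => [|d IHd] n x.
  rewrite inE thinmx0 eqxx; split=> // _; split=> [|[]//].
  by rewrite /cross_polytope /= /l1norm big_ord0.
have absE (z : int) : `|z%:~R : R| = (absz z)%:R by rewrite -intr_norm -abszE.
split=> [[]|/allpairsPdep[z [y [zn /IHd[+ inty]]]] ->]; last first.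
  rewrite mem_int_range in zn.
  rewrite /cross_polytope /= => yn; split.
    by rewrite /= l1norm_row_mx absE -lerBrDl -natrB.
  by apply/integer_points_row_mx; split => //; rewrite intr_int.
rewrite {1}/cross_polytope /mkset -[x](@hsubmxK R 1 1 d).
rewrite [lsubmx _]mx11_scalar l1norm_row_mx.
move: (lsubmx _ _ _) (rsubmx _) => t y le_n.
move=> /integer_points_row_mx[/intrP[z tz] inty].
rewrite tz absE in le_n.
have zn : (absz z <= n)%N.
  by rewrite -(ler_nat R); apply: le_trans le_n; rewrite lerDl l1norm_ge0.
apply/allpairsPdep; exists z, y; rewrite mem_int_range tz; split=> //.
by apply/IHd; split=> //; rewrite /cross_polytope /= natrB // lerBrDl.
Qed.

Lemma uniq_ball_points d n : uniq (ball_points d n).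
Proof.
elim: d n => [|d IHd] n //.
apply: allpairs_uniq_dep => [||[z y] [z' y'] _ _ /= eq_zy].
- exact: uniq_int_range.
- by [].
have [/matrixP/(_ ord0 ord0) + ->] := @eq_row_mx R 1 1 d _ _ _ _ eq_zy.
by rewrite !mxE !eqxx !mulr1n => /intr_inj ->.
Qed.

Lemma card_ballE d n : card_ball R d n = delannoy d n.
Proof.
rewrite -size_ball_points; apply: card_fset_set_seq.
  exact: uniq_ball_points.
exact: mem_ball_points.
Qed.

(** The norm of an integer point is a natural number, so a point of the ball of radius n + 1 off its
    boundary lies in the ball of radius n. *)
Lemma card_sphereS d n :
  (card_sphere R d n.+1 + delannoy d n)%N = delannoy d n.+1.
Proof.
pose P (x : 'rV[R]_d) := l1norm x == n.+1%:R.
have -> : card_sphere R d n.+1 = size (seq.filter P (ball_points d n.+1)).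
  apply: card_fset_set_seq; first by rewrite filter_uniq ?uniq_ball_points.
  move=> x; rewrite mem_filter; split => [[xn intx]|].
    rewrite /P xn eqxx /=; apply/mem_ball_points; split=> //.
    by rewrite /cross_polytope /= xn.
  by move=> /andP[/eqP xn /mem_ball_points[_ intx]].
have -> : delannoy d n = size (seq.filter (predC P) (ball_points d n.+1)).
  rewrite -card_ballE; apply: card_fset_set_seq.
    by rewrite filter_uniq ?uniq_ball_points.
  move=> x; rewrite mem_filter /= /P; split => [[xn intx]|].
    rewrite (lt_eqF (le_lt_trans xn _)) ?ltr_nat //=.
    apply/mem_ball_points; split=> //; rewrite /cross_polytope /=.
    by apply: le_trans xn _; rewrite ler_nat.
  move=> /andP[neq /mem_ball_points[xn intx]]; split=> //.
  have /natrP[m xm] : l1norm x \is a Num.nat.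
    by apply: rpred_sum => i _; rewrite natr_norm_int.
  move: neq xn; rewrite /cross_polytope /= xm eqr_nat !ler_nat; lia.
by rewrite !size_filter count_predC size_ball_points.
Qed.

End BallCount.

(** * Contiguity relations; comparison of sphere and ball *)

(* Both sides are the coefficient of [z ^ n] in
   [(1 + z) * f' = d * f + (d + 1) * (1 + z) / (1 - z) * f], where
   [f = (1 + z) ^ d / (1 - z) ^ (d + 1)] generates the numbers [delannoy d n]. *)
Lemma delannoy_contiguous d n :
  (n.+1 * delannoy d n.+1 + n * delannoy d n =
   d.+1 * delannoy d.+1 n + d * delannoy d n)%N.
Proof.
have delannoy1n m : delannoy 1 m = m.*2.+1.
  by elim: m => // m IHm; rewrite delannoySS IHm /=; lia.
elim: d n => [|d IHd] n; first by rewrite delannoy1n /=; lia.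
elim: n => [|n IHn].
  by rewrite delannoyC delannoy1n !delannoyn0; lia.
(* The relations at (d, n), (d, n + 1) and (d + 1, n) add up, through the recurrence, to the one at
   (d + 1, n + 1). *)
have := IHd n.+1; have := IHd n; move: IHn.
rewrite (delannoySS d.+1 n) (delannoySS d n.+1) (delannoySS d n).
by nia.
Qed.

(** The contiguity relations at n and n + 1 are subtracted; by the Delannoy recurrence the terms at
    d + 1 drop out. *)
Lemma delannoy_rec d n :
  (n.+2 * delannoy d n.+2 =
   d.*2.+1 * delannoy d n.+1 + n.+1 * delannoy d n)%N.
Proof.
have := delannoy_contiguous d n.+1; have := delannoy_contiguous d n.
rewrite (delannoySS d n); nia.
Qed.

(** This is the preceding recurrence at n = -1. The factor 1 stands for [n.+1] at n = 0 in the ratio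
    bounds. *)
Lemma delannoy_rec0 d : (1 * delannoy d 1 = d.*2.+1 * delannoy d 0)%N.
Proof. by have := delannoy_contiguous d 0; rewrite !delannoyn0; lia. Qed.

(** For n <= d the contiguity relation gives (n + 1) D(d, n + 1) >= (d + 1) D(d + 1, n) >= (n + 1)
    D(d + 1, n). *)
Lemma delannoy_balanced d n :
  (n <= d)%N -> (delannoy d.+1 n <= delannoy d n.+1)%N.
Proof.
move=> le_nd; rewrite -(leq_pmul2l (ltn0Sn n)).
have le_mul m : (n * m <= d * m)%N by rewrite leq_mul2r le_nd orbT.
have := delannoy_contiguous d n.
by have := le_mul (delannoy d n); have := le_mul (delannoy d.+1 n); lia.
Qed.

(** By the recurrence, the sphere for (d + 1, n + 1) has D(d, n + 1) + D(d, n) points. By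
    [delannoy_balanced] this is at least D(d + 1, n), the number of the other points of the ball. *)
Lemma card_ball_le_sphere (R : realType) d n : (0 < n)%N -> (n <= d)%N ->
  (card_ball R d n <= 2 * card_sphere R d n)%N.
Proof.
case: n d => [|n] [|d] // _ le_nd.
have := card_sphereS R d.+1 n; rewrite card_ballE delannoySS.
by have := delannoy_balanced (le_nd : (n <= d)%N); lia.
Qed.

Lemma card_sphere_le_ball (R : realType) d n : (0 < n)%N ->
  (card_sphere R d n <= card_ball R d n)%N.
Proof. by case: n => // n _; have := card_sphereS R d n; rewrite card_ballE; lia. Qed.

(** * Ratios of consecutive Delannoy numbers *)

Section Ratio.
Variable R : realType.

(** The larger root of w^2 = 2 d w + n^2; for d > 0, the positive fixed point of w -> 2 d + n^2 / w,
    which governs the ratios. *)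
Definition saddle (d n : nat) : R :=
  d%:R + Num.sqrt (d%:R ^+ 2 + n%:R ^+ 2).

Lemma saddle_sqr d n :
  saddle d n ^+ 2 = 2 * d%:R * saddle d n + n%:R ^+ 2.
Proof.
have : Num.sqrt (d%:R ^+ 2 + n%:R ^+ 2 : R) ^+ 2 = d%:R ^+ 2 + n%:R ^+ 2.
  by rewrite sqr_sqrtr // addr_ge0 // sqr_ge0.
rewrite /saddle; move: (Num.sqrt _) => s; nra.
Qed.

Lemma saddle_ge d n : 2 * d%:R <= saddle d n.
Proof.
have : Num.sqrt (d%:R ^+ 2 : R) <= Num.sqrt (d%:R ^+ 2 + n%:R ^+ 2).
  by apply: ler_wsqrtr; rewrite lerDl sqr_ge0.
by rewrite sqrtr_sqr ger0_norm // /saddle; lra.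
Qed.

Lemma saddle_mono d m n : (m <= n)%N -> saddle d m <= saddle d n.
Proof.
move=> mn; rewrite lerD2l; apply: ler_wsqrtr; rewrite lerD2l.
by rewrite ler_sqr ?nnegrE ?ler_nat.
Qed.

(** With s = sqrt (d^2 + n^2) >= n, one has (s + 1)^2 >= s^2 + 2 n + 1. *)
Lemma saddleS_le d n : saddle d n.+1 <= saddle d n + 1.
Proof.
rewrite /saddle -addrA lerD2l; set s := Num.sqrt (_ + n%:R ^+ 2).
have s0 : 0 <= s by exact: sqrtr_ge0.
have n0 : 0 <= n%:R :> R by [].
have ss : s ^+ 2 = d%:R ^+ 2 + n%:R ^+ 2.
  by rewrite sqr_sqrtr // addr_ge0 // sqr_ge0.
have ns : n%:R <= s by rewrite -ler_sqr ?nnegrE // ss lerDr sqr_ge0.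
rewrite -[leRHS]ger0_norm -?sqrtr_sqr; last lra.
by apply: ler_wsqrtr; rewrite -natr1; nra.
Qed.

(** Read as ratios: N D / D' lies between N^2 / (W0 + 2) and N^2 / W0, which are respectively at
    least N^2 / W - 1 and at most N^2 / W + 1. Since W = 2 a + N^2 / W, adding 2 a + 1 lands between
    W and W + 2. *)
Lemma ratio_step (a N W0 W D D' X : R) : 0 < a -> 0 < N <= a ->
  2 * a <= W0 -> W0 <= W <= W0 + 1 -> W ^+ 2 = 2 * a * W + N ^+ 2 ->
  0 <= D -> 0 <= D' -> W0 * D <= N * D' <= (W0 + 2) * D ->
  X = (2 * a + 1) * D' + N * D -> W * D' <= X <= (W + 2) * D'.
Proof.
move=> a0 /andP[N0 Na] aW0 /andP[W0W WW0] Wsqr D0 D'0 /andP[lo hi] ->.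
have W0gt : 0 < W0 by lra.
have Wgt : 0 < W by lra.
have NN : N ^+ 2 <= a ^+ 2 by rewrite ler_sqr ?nnegrE //; lra.
have WE : W = 2 * a + N ^+ 2 / W by apply: (mulfI (lt0r_neq0 Wgt)); field: Wsqr; lra.
have NDlo : N ^+ 2 / (W0 + 2) * D' <= N * D.
  rewrite mulrAC ler_pdivrMr; last lra.
  nra.
have NDhi : N * D <= N ^+ 2 / W0 * D'.
  rewrite mulrAC ler_pdivlMr //; nra.
(* From N <= a, both W and W0 are at least 2 N. *)
have W2 : 2 * N ^+ 2 <= W * (W0 + 2) by nra.
have W1 : N ^+ 2 <= W * W0 by nra.
have c1 : N ^+ 2 / W - N ^+ 2 / (W0 + 2) <= 1.
  have -> : N ^+ 2 / W - N ^+ 2 / (W0 + 2) =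
    N ^+ 2 * (W0 + 2 - W) / (W * (W0 + 2)) by field; rewrite !gt_eqF //; lra.
  by rewrite ler_pdivrMr ?mulr_gt0 //; nra.
have c2 : N ^+ 2 / W0 - N ^+ 2 / W <= 1.
  have -> : N ^+ 2 / W0 - N ^+ 2 / W =
    N ^+ 2 * (W - W0) / (W * W0) by field; rewrite !gt_eqF.
  by rewrite ler_pdivrMr ?mulr_gt0 //; nra.
by apply/andP; split; nra.
Qed.

Lemma delannoy_ratio d n : (0 < d)%N -> (n <= d)%N ->
  saddle d n * (delannoy d n)%:R <= n.+1%:R * (delannoy d n.+1)%:R
    <= (saddle d n + 2) * (delannoy d n)%:R.
Proof.
move=> d0; elim: n => [|n IHn] nd.
  (* At n = 0 the ratio is 2 d + 1, in the middle of [2 d, 2 d + 2]. *)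
  have -> : saddle d 0 = 2 * d%:R.
    by rewrite /saddle expr0n addr0 sqrtr_sqr ger0_norm //; ring.
  have -> : 1%:R * (delannoy d 1)%:R = 2 * d%:R + 1 :> R.
    by rewrite -natrM delannoy_rec0 delannoyn0 muln1 -addn1 -mul2n natrD natrM.
  by rewrite delannoyn0 mulr1; apply/andP; split; lra.
apply: (@ratio_step d%:R n.+1%:R (saddle d n) _ (delannoy d n)%:R) => //.
- by rewrite ltr0n.
- by rewrite ltr0n ler_nat.
- exact: saddle_ge.
- by rewrite saddle_mono //= saddleS_le.
- exact: saddle_sqr.
- exact/IHn/ltnW.
- rewrite -natrM delannoy_rec natrD !natrM; congr (_ * _ + _).
  by rewrite -addn1 -mul2n natrD natrM.
Qed.

End Ratio.

(** * Two logarithm bounds; the phase function and its derivative *)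

Section Phase.
Variable R : realType.
Implicit Types (x y : R) (f g : R -> R).

Lemma MVT_is_derive (f df : R -> R) (a b : R) : a <= b ->
  (forall x, a <= x <= b -> is_derive x 1 f (df x)) ->
  exists2 c, a <= c <= b & f b - f a = df c * (b - a).
Proof.
move=> ab fdf.
have [||c cab E] := @MVT_segment R f df a b ab.
- by move=> x; rewrite in_itv /= => /andP[/ltW ax /ltW xb]; apply: fdf; rewrite ax.
- apply: derivable_within_continuous => x; rewrite in_itv /= => xab.
  by have [] := fdf x xab.
- by exists c => //; rewrite in_itv in cab.
Qed.

Lemma is_derive_idfun x : is_derive x (1 : R) (fun y => y) 1.
Proof. exact: is_derive_id. Qed.

Lemma is_derive_const (c x : R) : is_derive x (1 : R) (fun=> c) 0.
Proof. exact: is_derive_cst. Qed.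

Lemma is_derive_add f g x (a b : R) :
  is_derive x 1 f a -> is_derive x 1 g b ->
  is_derive x 1 (fun y => f y + g y) (a + b).
Proof. exact: is_deriveD. Qed.

Lemma is_derive_sub f g x (a b : R) :
  is_derive x 1 f a -> is_derive x 1 g b ->
  is_derive x 1 (fun y => f y - g y) (a - b).
Proof. exact: is_deriveB. Qed.

Lemma is_derive_mul f g x (a b : R) :
  is_derive x 1 f a -> is_derive x 1 g b ->
  is_derive x 1 (fun y => f y * g y) (a * g x + f x * b).
Proof.
move=> fa gb; apply: is_derive_eq (is_deriveM fa gb) _.
by rewrite addrC /GRing.scale /= [g x * a]mulrC.
Qed.

Lemma is_derive_inv f x (a : R) : f x != 0 ->
  is_derive x 1 f a -> is_derive x 1 (fun y => (f y)^-1) (- a / f x ^+ 2).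
Proof.
move=> fx fa; apply: is_derive_eq (is_deriveV fx fa) _.
by rewrite /GRing.scale /= !mulNr mulrC.
Qed.

Lemma is_derive_ln f x (a : R) : 0 < f x ->
  is_derive x 1 f a -> is_derive x 1 (fun y => ln (f y)) (a / f x).
Proof.
move=> fx fa; rewrite mulrC.
exact: (@is_derive1_comp R (@ln R) f x _ _ (is_derive1_ln fx) fa).
Qed.

(** The right side minus the left, as a function of y = 1 + x, vanishes at 1 and has derivative (1 -
    1 / y)^2 / 2. *)
Lemma ln_le_trapezoid x : 0 <= x -> ln (1 + x) <= ((1 + x) - (1 + x)^-1) / 2.
Proof.
move=> x0; pose f y := (y - y^-1) / 2 - ln y : R.
have [|y /andP[y1 _]|c /andP[c1 _]] :=
    @MVT_is_derive f (fun y => (1 - y^-1) ^+ 2 / 2) 1 (1 + x).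
- by rewrite lerDl.
- have y0 : y != 0 by lra.
  apply: is_derive_eq.
    apply: is_derive_sub.
      apply: is_derive_mul (is_derive_const _ _).
      apply: is_derive_sub (is_derive_idfun y) _.
      exact: is_derive_inv (is_derive_idfun y).
    by apply: is_derive_ln (is_derive_idfun y); lra.
  by rewrite /=; field.
rewrite /f ln1 invr1 => E.
have : 0 <= (1 - c^-1) ^+ 2 / 2 * (1 + x - 1).
  by rewrite mulr_ge0 ?divr_ge0 ?sqr_ge0 // addrAC subrr add0r.
rewrite -E; lra.
Qed.

(** The function ln (1 + y) - 2 y / (2 + y) vanishes at 0 and has derivative (y / (2 + y))^2 / (1 +
    y). *)
Lemma ln_ge_midpoint x : 0 <= x -> 2 * x / (2 + x) <= ln (1 + x).
Proof.
move=> x0; pose f y := ln (1 + y) - 2 * y / (2 + y) : R.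
have [//|y /andP[y0 _]|c /andP[c0 _]] :=
    @MVT_is_derive f (fun y => (y / (2 + y)) ^+ 2 / (1 + y)) 0 x.
  have D c : is_derive y (1 : R) (fun z => c + z) (0 + 1).
    exact: is_derive_add (is_derive_const c y) (is_derive_idfun y).
  have D2 := is_derive_mul (is_derive_const 2 y) (is_derive_idfun y).
  have y1 : 0 < 1 + y by lra.
  have y2 : 2 + y != 0 by lra.
  apply: is_derive_eq.
    exact: is_derive_sub (is_derive_ln y1 (D 1))
      (is_derive_mul D2 (is_derive_inv y2 (D 2))).
  by rewrite /=; field; apply/andP; split; lra.
rewrite /f !addr0 ln1 mulr0 mul0r !subr0 => E.
have : 0 <= (c / (2 + c)) ^+ 2 / (1 + c) * x.
  by rewrite mulr_ge0 ?divr_ge0 ?sqr_ge0 ?addr_ge0.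
rewrite -E; lra.
Qed.

(** With x = n / d and d > 0 this rescales the square root: [saddle d n] is d (1 + [hyp x]). *)
Definition hyp x : R := Num.sqrt (1 + x ^+ 2).

Lemma hyp_sqr x : hyp x ^+ 2 = 1 + x ^+ 2.
Proof. by rewrite sqr_sqrtr // addr_ge0 // sqr_ge0. Qed.

Lemma hyp_ge1 x : 1 <= hyp x.
Proof.
by rewrite -(@ler_sqr R) ?nnegrE ?sqrtr_ge0 // hyp_sqr expr1n lerDl sqr_ge0.
Qed.

Lemma hyp_gt0 x : 0 < hyp x.
Proof. exact: lt_le_trans (hyp_ge1 x). Qed.

Lemma hyp_gtN x : 0 < x + hyp x.
Proof.
have := hyp_sqr x; have := hyp_ge1 x; nra.
Qed.

Lemma le_hyp x y : 0 <= x -> x <= y -> hyp x <= hyp y.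
Proof.
move=> x0 xy; apply: ler_wsqrtr; rewrite lerD2l ler_sqr ?nnegrE //.
exact: le_trans xy.
Qed.

Lemma is_derive_hyp x : is_derive x (1 : R) hyp (x / hyp x).
Proof.
have x1 : 0 < 1 + x ^+ 2 by rewrite -hyp_sqr exprn_gt0 ?hyp_gt0.
have D : is_derive x (1 : R) (fun y => 1 + y * y) (0 + (1 * x + x * 1)).
  apply: is_derive_add (is_derive_const _ _) _.
  exact: is_derive_mul (is_derive_idfun x) (is_derive_idfun x).
apply: is_derive_eq.
  exact: (@is_derive1_comp R (@Num.sqrt R) _ x _ _ (is_derive1_sqrt x1) D).
by rewrite -/(hyp x); field; rewrite gt_eqF ?hyp_gt0.
Qed.

(* [d * phase (n / d) + n * ln (2 * d)] is the integral over [0, n] of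
   [ln (d + sqrt (d ^ 2 + x ^ 2))]. *)
Definition phase x : R := ln (x + hyp x) + ln ((1 + hyp x) / 2) * x - x.

Lemma phase0 : phase 0 = 0.
Proof.
by rewrite /phase mulr0 subr0 addr0 add0r /hyp expr0n addr0 sqrtr1 ln1.
Qed.

Lemma is_derive_ln_hyp x : is_derive x (1 : R)
  (fun y => ln ((1 + hyp y) / 2)) (x / (hyp x * (1 + hyp x))).
Proof.
have h0 := hyp_gt0 x; have h1 : 0 < 1 + hyp x by rewrite addr_gt0.
apply: is_derive_eq.
  apply: is_derive_ln; first by rewrite divr_gt0.
  apply: is_derive_mul (is_derive_const _ _).
  exact: is_derive_add (is_derive_const _ _) (is_derive_hyp x).
by rewrite /=; field; rewrite !gt_eqF.
Qed.

(** The first term is the inverse hyperbolic sine, of derivative 1 / h with h = [hyp x].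
    Differentiating the logarithm in the second term contributes 1 - 1 / h, and the sum 1 cancels
    against the derivative of -x. *)
Lemma is_derive_phase x : is_derive x (1 : R) phase (ln ((1 + hyp x) / 2)).
Proof.
have h0 := hyp_gt0 x; have h1 : 0 < 1 + hyp x by rewrite addr_gt0.
have h2 := hyp_gtN x.
apply: is_derive_eq.
  apply: is_derive_sub (is_derive_idfun x).
  apply: is_derive_add.
    apply: is_derive_ln; first exact: h2.
    exact: is_derive_add (is_derive_idfun x) (is_derive_hyp x).
  exact: is_derive_mul (is_derive_ln_hyp x) (is_derive_idfun x).
have -> : (1 + x / hyp x) / (x + hyp x) = (hyp x)^-1.
  by field; rewrite !gt_eqF.
have -> : x / (hyp x * (1 + hyp x)) * x = 1 - (hyp x)^-1.
  rewrite mulrAC -expr2; have -> : x ^+ 2 = hyp x ^+ 2 - 1 by rewrite hyp_sqr; ring.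
  by field; rewrite !gt_eqF.
by rewrite mulr1; ring.
Qed.

(** The derivative of [phase] is nondecreasing on x >= 0, so the mean value lies between its values
    at the endpoints. *)
Lemma phase_increment x y : 0 <= x -> x < y ->
  ln ((1 + hyp x) / 2) * (y - x) <= phase y - phase x <=
  ln ((1 + hyp y) / 2) * (y - x).
Proof.
move=> x0 xy.
have [z _|c /andP[xc cy] ->] :=
    @MVT_is_derive phase (fun z => ln ((1 + hyp z) / 2)) x y (ltW xy).
  exact: is_derive_phase.
have lnh u v : 0 <= u -> u <= v -> ln ((1 + hyp u) / 2) <= ln ((1 + hyp v) / 2).
  move=> u0 uv; have := hyp_gt0 u; have := hyp_gt0 v; have := le_hyp u0 uv.
  by move=> *; rewrite ler_ln ?posrE; lra.
by rewrite !ler_pM2r ?subr_gt0 // !lnh // (le_trans x0).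
Qed.

End Phase.

(** * Comparison of n! D(d, n) with the exponential of the phase *)

Section Comparison.
Variable R : realType.

(** The smooth substitute for the product of w_i = [saddle d i] over i < n. *)
Definition phase_prod (d n : nat) : R :=
  (2 * d%:R) ^+ n * expR (d%:R * phase (n%:R / d%:R)).

Lemma phase_prod_gt0 d n : (0 < d)%N -> 0 < phase_prod d n.
Proof. by move=> d0; rewrite mulr_gt0 ?expR_gt0 // exprn_gt0 // mulr_gt0 ?ltr0n. Qed.

Lemma saddleE d n : (0 < d)%N ->
  saddle R d n = d%:R * (1 + hyp (n%:R / d%:R)).
Proof.
move=> d0; have a0 : 0 < d%:R :> R by rewrite ltr0n.
rewrite /saddle mulrDr mulr1; congr (_ + _).
rewrite -[X in X * hyp _]ger0_norm ?ler0n // -sqrtr_sqr /hyp -sqrtrM ?sqr_ge0 //.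
by congr Num.sqrt; field; rewrite gt_eqF.
Qed.

(** The quotient of consecutive values is the exponential of the integral of ln w over [n, n + 1],
    where w is increasing. *)
Lemma phase_prod_ratio d n : (0 < d)%N ->
  saddle R d n * phase_prod d n <= phase_prod d n.+1 <=
  saddle R d n.+1 * phase_prod d n.
Proof.
move=> d0; have a0 : 0 < d%:R :> R by rewrite ltr0n.
rewrite /phase_prod.
have := @phase_increment R (n%:R / d%:R) (n.+1%:R / d%:R).
rewrite divr_ge0 ?ler0n // ltr_pM2r ?invr_gt0 // ltr_nat ltnS leqnn.
move=> /(_ isT isT).
have -> : n.+1%:R / d%:R - n%:R / d%:R = d%:R^-1 :> R.
  by rewrite -mulrBl -natr1 addrAC subrr add0r mul1r.
set x := n%:R / d%:R; set y := n.+1%:R / d%:R => /andP[lo hi].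
have h1 z : 0 < (1 + hyp z) / 2 :> R.
  by rewrite divr_gt0 // addr_gt0 // hyp_gt0.
have bound z : 2 * d%:R * expR (ln ((1 + hyp z) / 2)) = d%:R * (1 + hyp z) :> R.
  by rewrite lnK ?posrE //; field.
have -> : expR (d%:R * phase y) =
    expR (d%:R * phase x) * expR (d%:R * (phase y - phase x)).
  by rewrite -expRD; congr expR; ring.
rewrite exprS mulrACA !saddleE // -/x -/y -!bound.
set p := expR (d%:R * phase x); set Q := (2 * d%:R) ^+ n.
have p0 : 0 < Q * p.
  by rewrite mulr_gt0 ?expR_gt0 // exprn_gt0 // mulr_gt0.
rewrite -[_ * _ * (Q * p)]mulrA -[2 * d%:R * _ * (Q * p)]mulrA.
have -> : 2 * d%:R * p * (Q * expR (d%:R * (phase y - phase x))) =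
  2 * d%:R * (expR (d%:R * (phase y - phase x)) * (Q * p)) by ring.
rewrite !ler_pM2l ?mulr_gt0 // !ler_pM2r // !ler_expR.
by rewrite [d%:R * _]mulrC -(ler_pdivrMr _ _ a0) -(ler_pdivlMr _ _ a0) lo hi.
Qed.

Lemma saddle_le d n : (n <= d)%N -> saddle R d n <= 4 * d%:R.
Proof.
move=> nd; have nd' : n%:R <= d%:R :> R by rewrite ler_nat.
have d0 : 0 <= d%:R :> R by [].
have n0 : 0 <= n%:R :> R by [].
suff : Num.sqrt (d%:R ^+ 2 + n%:R ^+ 2) <= 3 * d%:R :> R by rewrite /saddle; lra.
rewrite -[leRHS]ger0_norm ?mulr_ge0 // -sqrtr_sqr; apply: ler_wsqrtr; nra.
Qed.

(** The upper bound for [phase_prod] is w_1 ... w_n, the lower bound for n! D(d, n) is w_0 ...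
    w_(n-1). The shift costs w_n / w_0 <= 4 d / (2 d) = 2; both factors are kept during the
    induction so that it telescopes. *)
Lemma fact_delannoy_ge d n : (0 < d)%N -> (n <= d)%N ->
  phase_prod d n <= 2 * (n`!%:R * (delannoy d n)%:R).
Proof.
move=> d0 nd; have a0 : 0 < d%:R :> R by rewrite ltr0n.
suff : 2 * d%:R * phase_prod d n <= saddle R d n * (n`!%:R * (delannoy d n)%:R).
  have := saddle_le nd; have : 0 <= n`!%:R * (delannoy d n)%:R :> R by rewrite mulr_ge0.
  move: (n`!%:R * _) => X X0 sad H.
  rewrite -(ler_pM2l (_ : 0 < 2 * d%:R)) ?mulr_gt0 //.
  by apply: le_trans H _; nra.
elim: n nd => [|n IHn] nd.
  rewrite /phase_prod expr0 mul0r phase0 mulr0 expR0 fact0 delannoyn0 !mulr1.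
  exact: saddle_ge.
have /andP[lo _] := delannoy_ratio R d0 (ltnW nd).
have /andP[_ hi] := phase_prod_ratio n d0.
have sad0 : 0 < saddle R d n.+1.
  by apply: lt_le_trans (saddle_ge R d n.+1); rewrite mulr_gt0.
have {}IHn := IHn (ltnW nd).
rewrite factS natrM.
have -> : n.+1%:R * n`!%:R * (delannoy d n.+1)%:R =
  n`!%:R * (n.+1%:R * (delannoy d n.+1)%:R) :> R by ring.
apply: (@le_trans _ _ (2 * d%:R * (saddle R d n.+1 * phase_prod d n))).
  by rewrite ler_pM2l ?mulr_gt0.
rewrite mulrCA ler_pM2l //; apply: le_trans IHn _.
by rewrite mulrCA ler_wpM2l.
Qed.

(** Each ratio is at most w_n + 2 <= (1 + 1 / d) w_n <= exp (1 / d) w_n, as w_n >= 2 d. Over n <= d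
    steps the extra factors multiply to at most e. *)
Lemma fact_delannoy_le d n : (0 < d)%N -> (n <= d)%N ->
  n`!%:R * (delannoy d n)%:R <= expR 1 * phase_prod d n.
Proof.
move=> d0 nd; have a0 : 0 < d%:R :> R by rewrite ltr0n.
suff : n`!%:R * (delannoy d n)%:R <= expR (n%:R / d%:R) * phase_prod d n.
  move=> /le_trans; apply; rewrite ler_pM2r ?phase_prod_gt0 //.
  by rewrite ler_expR ler_pdivrMr // mul1r ler_nat.
elim: n nd => [|n IHn] nd.
  by rewrite /phase_prod expr0 mul0r phase0 mulr0 expR0 fact0 delannoyn0 !mulr1.
have /andP[_ hi] := delannoy_ratio R d0 (ltnW nd).
have /andP[lo _] := phase_prod_ratio n d0.
have {}IHn := IHn (ltnW nd).
rewrite factS natrM.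
have -> : n.+1%:R * n`!%:R * (delannoy d n.+1)%:R =
  n`!%:R * (n.+1%:R * (delannoy d n.+1)%:R) :> R by ring.
have sad := saddle_ge R d n.
have sad2 : saddle R d n + 2 <= expR (d%:R^-1) * saddle R d n.
  apply: (@le_trans _ _ ((1 + d%:R^-1) * saddle R d n)).
    by rewrite mulrDl mul1r lerD2l mulrC ler_pdivlMr.
  by rewrite ler_wpM2r ?expR_ge1Dx //; lra.
apply: (@le_trans _ _ (expR d%:R^-1 * saddle R d n * (n`!%:R * (delannoy d n)%:R))).
  rewrite [leRHS]mulrCA ler_wpM2l //; apply: le_trans hi _.
  by rewrite ler_wpM2r.
rewrite -natr1 mulrDl expRD mul1r.
rewrite [X in _ <= X * _]mulrC -!mulrA ler_pM2l ?expR_gt0 //.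
apply: le_trans (_ : expR (n%:R / d%:R) * (saddle R d n * phase_prod d n) <= _).
  by rewrite [leRHS]mulrCA ler_wpM2l //; lra.
by rewrite ler_pM2l ?expR_gt0.
Qed.

End Comparison.

(** * Stirling's bounds for the factorial *)

Section Stirling.
Variable R : realType.

Let stirling_exponent (n : nat) : R := (n%:R + 2^-1) * ln n%:R - n%:R.

(** The increment minus ln (n + 1) is (n + 1/2) ln (1 + 1/n) - 1. The midpoint bound makes it
    nonnegative; the trapezoid bound makes it at most 1 / (4 n (n + 1)), which telescopes. *)
Lemma stirling_exponent_step n : (0 < n)%N ->
  stirling_exponent n <= stirling_exponent n.+1 - ln n.+1%:R <=
  stirling_exponent n + (4 * n%:R)^-1 - (4 * n.+1%:R)^-1.
Proof.
move=> n0; have a0 : 0 < n%:R :> R by rewrite ltr0n.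
have an0 : n%:R != 0 :> R by rewrite gt_eqF.
have x0 : 0 <= n%:R^-1 :> R by rewrite invr_ge0.
have lnE : ln n.+1%:R = ln n%:R + ln (1 + n%:R^-1) :> R.
  rewrite -lnM ?posrE ?ltr_wpDr //; congr ln.
  by rewrite mulrDr mulr1 divff // natr1.
have := ln_le_trapezoid x0; have := ln_ge_midpoint x0.
rewrite /stirling_exponent lnE -[n.+1%:R]natr1; move: (ln (1 + _)) => L lo hi.
have lo' : 1 <= (n%:R + 2^-1) * L.
  apply: le_trans (_ : (n%:R + 2^-1) * (2 / n%:R / (2 + n%:R^-1)) <= _).
    by rewrite le_eqVlt; apply/orP; left; apply/eqP; field; rewrite an0 /=; lra.
  by rewrite ler_wpM2l //; lra.
have hi' : (n%:R + 2^-1) * L <= 1 + (4 * n%:R)^-1 - (4 * (n%:R + 1))^-1.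
  apply: le_trans (_ : (n%:R + 2^-1) *
      ((1 + n%:R^-1 - (1 + n%:R^-1)^-1) / 2) <= _).
    by rewrite ler_wpM2l //; lra.
  rewrite le_eqVlt; apply/orP; left; apply/eqP; field; rewrite an0 andbT; lra.
by apply/andP; split; lra.
Qed.

Lemma ln_fact_bounds n : (0 < n)%N ->
  stirling_exponent n <= ln n`!%:R <= stirling_exponent n + 1.
Proof.
move=> n0.
(* The difference is 1 at n = 1 and drops by at most 1 / (4 n) - 1 / (4 (n + 1)) at each step, so it
   loses at most 1/4 in all. *)
suff : 1 - 4^-1 + (4 * n%:R)^-1 <= ln n`!%:R - stirling_exponent n <= 1.
  have : 0 <= (4 * n%:R)^-1 :> R by rewrite invr_ge0 mulr_ge0.
  by move=> ? /andP[? ?]; apply/andP; split; lra.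
case: n n0 => // n _; elim: n => [|n IHn].
  by rewrite /stirling_exponent factS fact0 ln1; apply/andP; split; lra.
have /andP[lo hi] := @stirling_exponent_step n.+1 isT.
rewrite factS natrM lnM ?posrE ?ltr0n ?fact_gt0 //.
move: IHn lo hi; move: (stirling_exponent _) (stirling_exponent _) => s s'.
move: (ln _ : R) (ln _ : R) ((4 * n.+1%:R)^-1 : R) ((4 * n.+2%:R)^-1 : R).
by move=> l l' i j /andP[? ?] ? ?; apply/andP; split; lra.
Qed.

Lemma expR_stirling_exponent n : (0 < n)%N ->
  expR (stirling_exponent n) = n%:R ^+ n * Num.sqrt n%:R / expR 1 ^+ n.
Proof.
move=> n0; have a0 : 0 < n%:R :> R by rewrite ltr0n.
rewrite /stirling_exponent expRD mulrDl expRD expRM_natl lnK ?posrE //.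
have -> : expR (- n%:R) = (expR 1 ^+ n)^-1 :> R.
  by rewrite -expRM_natl mulr1 expRN.
congr (_ * _ / _).
rewrite -[LHS]ger0_norm ?expR_ge0 // -sqrtr_sqr -expRM_natl.
by rewrite mulrA divff // mul1r lnK.
Qed.

Lemma fact_ge n : (0 < n)%N ->
  n%:R ^+ n * Num.sqrt n%:R / expR 1 ^+ n <= n`!%:R :> R.
Proof.
move=> n0; have /andP[lo _] := ln_fact_bounds n0.
by rewrite -expR_stirling_exponent // -[leRHS]lnK ?posrE ?ltr0n ?fact_gt0 // ler_expR.
Qed.

Lemma fact_le n : (0 < n)%N ->
  n`!%:R <= expR 1 * (n%:R ^+ n * Num.sqrt n%:R / expR 1 ^+ n) :> R.
Proof.
move=> n0; have /andP[_ hi] := ln_fact_bounds n0.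
rewrite -expR_stirling_exponent // -expRD -[leLHS]lnK ?posrE ?ltr0n ?fact_gt0 //.
by rewrite ler_expR addrC.
Qed.

End Stirling.

(** * The main term and its closed forms *)

Section ClosedForms.
Variable R : realType.

(** This is [phase_prod] divided by Stirling's expression n^n sqrt n / e^n. The closed forms of the
    statement are rewritings of it. *)
Definition saddle_value (d n : nat) : R :=
  (2 * expR 1 / alpha R d n) ^+ n * (Num.sqrt n%:R)^-1 *
  expR (d%:R * phase (alpha R d n)).

Lemma saddle_value_gt0 d n : (0 < d)%N -> (0 < n)%N -> 0 < saddle_value d n.
Proof.
move=> d0 n0; rewrite !mulr_gt0 ?expR_gt0 // ?invr_gt0 ?sqrtr_gt0 ?ltr0n //.
by rewrite exprn_gt0 // !(mulr_gt0, invr_gt0) ?expR_gt0 ?ltr0n.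
Qed.

Lemma saddle_value_stirling d n : (0 < d)%N -> (0 < n)%N ->
  saddle_value d n * (n%:R ^+ n * Num.sqrt n%:R / expR 1 ^+ n) = phase_prod R d n.
Proof.
move=> d0 n0; rewrite /saddle_value /alpha /phase_prod.
have a0 : d%:R != 0 :> R by rewrite pnatr_eq0 -lt0n.
have b0 : n%:R != 0 :> R by rewrite pnatr_eq0 -lt0n.
have s0 : Num.sqrt n%:R != 0 :> R by rewrite gt_eqF // sqrtr_gt0 ltr0n.
have e0 : expR 1 != 0 :> R by rewrite gt_eqF // expR_gt0.
have -> : 2 * expR 1 / (n%:R / d%:R) = 2 * d%:R * expR 1 / n%:R :> R.
  by field; rewrite a0 b0.
rewrite expr_div_n [(2 * d%:R * expR 1) ^+ n]exprMn.
by field; rewrite s0 !expf_neq0.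
Qed.

Lemma delannoy_le_saddle_value d n : (0 < d)%N -> (0 < n)%N -> (n <= d)%N ->
  (delannoy d n)%:R <= expR 1 * saddle_value d n.
Proof.
move=> d0 n0 nd; rewrite -(ler_pM2l (_ : 0 < n`!%:R)) ?ltr0n ?fact_gt0 //.
apply: le_trans (fact_delannoy_le R d0 nd) _.
rewrite -saddle_value_stirling // [leRHS]mulrCA ler_pM2l ?expR_gt0 //.
by rewrite [leRHS]mulrC ler_pM2l ?saddle_value_gt0 // fact_ge.
Qed.

Lemma saddle_value_le_delannoy d n : (0 < d)%N -> (0 < n)%N -> (n <= d)%N ->
  saddle_value d n <= 2 * expR 1 * (delannoy d n)%:R.
Proof.
move=> d0 n0 nd.
have st0 : 0 < n%:R ^+ n * Num.sqrt n%:R / expR 1 ^+ n :> R.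
  by rewrite !mulr_gt0 ?invr_gt0 ?exprn_gt0 ?sqrtr_gt0 ?expR_gt0 ?ltr0n.
rewrite -(ler_pM2r st0) saddle_value_stirling //.
apply: le_trans (fact_delannoy_ge R d0 nd) _.
have := fact_le R n0; move: (_ / _) => st le_st.
have -> : 2 * expR 1 * (delannoy d n)%:R * st =
  2 * (expR 1 * st * (delannoy d n)%:R) by ring.
by rewrite ler_pM2l // ler_wpM2r.
Qed.

(** Since d x = n, the exponential of d [phase x] is (x + h)^d ((1 + h) / 2)^n e^(-n) with h =
    [hyp x], and e^(-n) cancels e^n. *)
Lemma saddle_valueE d n : (0 < d)%N -> (0 < n)%N ->
  let x := alpha R d n in
  saddle_value d n =
    (x + hyp x) ^+ d * ((1 + hyp x) / x) ^+ n * (Num.sqrt n%:R)^-1.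
Proof.
move=> d0 n0 x.
have dx : d%:R * x = n%:R by rewrite /x /alpha mulrC divfK // pnatr_eq0 -lt0n.
have h0 := hyp_gt0 x.
have x0 : x != 0 by rewrite gt_eqF // divr_gt0 ?ltr0n.
rewrite /saddle_value -/x /phase.
have -> : d%:R * (ln (x + hyp x) + ln ((1 + hyp x) / 2) * x - x) =
    d%:R * ln (x + hyp x) + n%:R * ln ((1 + hyp x) / 2) - n%:R * 1.
  by rewrite -dx; ring.
rewrite !expRD expRN !expRM_natl !lnK ?posrE ?hyp_gtN //; last first.
  by rewrite divr_gt0 // addr_gt0.
rewrite -exprVn.
have -> : (1 + hyp x) / x = 2 * expR 1 / x * ((1 + hyp x) / 2) * (expR 1)^-1.
  by field; rewrite x0 gt_eqF ?expR_gt0.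
by rewrite !exprMn; ring.
Qed.

(** This is (h - 1) (h + 1) = x^2 for h = [hyp x]. *)
Lemma hyp_subE (x : R) : x != 0 -> (1 + hyp x) / x = x / (hyp x - 1).
Proof.
move=> x0; have hx := hyp_sqr x; have h1 := hyp_ge1 x.
have h2 : hyp x - 1 != 0.
  apply: contra_neq x0 => /eqP; rewrite subr_eq0 => /eqP h.
  by apply/eqP; rewrite -sqrf_eq0; apply/eqP; move: hx; rewrite h expr1n; lra.
by apply/eqP; rewrite eqr_div //; apply/eqP; ring: hx.
Qed.

(** With h = [hyp x] and r = (h - 1) / x, the identity h^2 = 1 + x^2 gives (1 + r) / (1 - r) = x + h
    and 1 / r = (1 + h) / x. *)
Lemma saddle_value_rho d n : (0 < d)%N -> (0 < n)%N ->
  let r := rho R d n in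
  saddle_value d n = ((1 + r) / (1 - r)) ^+ d * r ^- n * (Num.sqrt n%:R)^-1.
Proof.
move=> d0 n0 r; rewrite saddle_valueE //; set x := alpha R d n.
have xgt0 : 0 < x by rewrite divr_gt0 ?ltr0n.
have x0 : x != 0 by rewrite gt_eqF.
have rE : r = (hyp x - 1) / x by [].
have hx := hyp_sqr x; have h1 := hyp_ge1 x.
congr (_ ^+ _ * _ * _).
  have h2 : 1 - r != 0.
    rewrite rE subr_eq0 eq_sym; apply/eqP => /(canRL (divfK x0)).
    by rewrite mul1r => h; move: hx; nra.
  apply: (canRL (mulfK h2)); rewrite rE; field: hx.
  by [].
by rewrite -exprVn hyp_subE //; clearbody x; rewrite rE invf_div.
Qed.

(** Here s = d h and n = d x, so d / (s - n) = 1 / (h - x) = h + x and n / (s - d) = x / (h - 1). *)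
Lemma saddle_value_sqrt d n : (0 < d)%N -> (0 < n)%N ->
  let s : R := Num.sqrt (d%:R ^+ 2 + n%:R ^+ 2) in
  saddle_value d n = (d%:R / (s - n%:R)) ^+ d * (n%:R / (s - d%:R)) ^+ n
    * (Num.sqrt n%:R)^-1.
Proof.
move=> d0 n0 s; rewrite saddle_valueE //; set x := alpha R d n.
have a0 : 0 < d%:R :> R by rewrite ltr0n.
have xgt0 : 0 < x by rewrite divr_gt0 ?ltr0n.
have sE : s = d%:R * hyp x.
  have := saddleE R n d0; rewrite /saddle mulrDr mulr1.
  by move=> /addrI.
have nE : n%:R = d%:R * x :> R by rewrite mulrC divfK // gt_eqF.
have hx := hyp_sqr x; have h1 := hyp_ge1 x.
have h2 : hyp x - x != 0 by rewrite subr_eq0; apply/eqP => h; move: hx; rewrite h; lra.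
rewrite hyp_subE ?gt_eqF // sE nE; congr (_ ^+ _ * _ ^+ _ * _).
  rewrite -mulrBr -{1}[d%:R]mulr1 -mulf_div divff ?gt_eqF // mul1r.
  by apply: (canRL (mulfK h2)); ring: hx.
by rewrite -[X in _ = _ / (_ - X)]mulr1 -mulrBr -mulf_div divff ?gt_eqF // mul1r.
Qed.

End ClosedForms.

(** * Equivalence up to constants of ball, sphere and main term *)

Section Approx.
Variable R : realType.
Implicit Types (P Q : nat -> nat -> bool) (X Y Z : nat -> nat -> R).

Lemma approx_on_trans P X Y Z :
  approx_on P X Y -> approx_on P Y Z -> approx_on P X Z.
Proof.
have trans U V W : lesssim_on P U V -> lesssim_on P V W -> lesssim_on P U W.
  move=> [c c0 UV] [c' c'0 VW]; exists (c * c'); rewrite ?mulr_gt0 // => d n *.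
  by rewrite (le_trans (UV _ _ _ _ _)) // -mulrA ler_pM2l // VW.
by move=> [XY YX] [YZ ZY]; split; [exact: trans XY YZ|exact: trans ZY YX].
Qed.

Lemma approx_on_sym P X Y : approx_on P X Y -> approx_on P Y X.
Proof. by case. Qed.

Lemma approx_on_sub P Q X Y : (forall d n, Q d n -> P d n) ->
  approx_on P X Y -> approx_on Q X Y.
Proof.
by move=> QP [[c c0 XY] [c' c'0 YX]];
  split; [exists c|exists c'] => // d n d0 n0 /QP; [exact: XY|exact: YX].
Qed.

Lemma approx_on_eqr P X Y Z :
  (forall d n, (0 < d)%N -> (0 < n)%N -> P d n -> Y d n = Z d n) ->
  approx_on P X Y -> approx_on P X Z.
Proof.
move=> YZ [[c c0 XY] [c' c'0 YX]]; split; [exists c|exists c'] => // d n d0 n0 Pdn.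
  by rewrite -YZ // XY.
by rewrite -YZ // YX.
Qed.

Lemma ball_approx_sphere : approx_on (fun d n => (n <= d)%N)
  (fun d n => (card_ball R d n)%:R : R) (fun d n => (card_sphere R d n)%:R).
Proof.
split; first exists 2 => // d n _ n0 nd.
  by rewrite -natrM ler_nat card_ball_le_sphere.
by exists 1 => // d n _ n0 _; rewrite mul1r ler_nat card_sphere_le_ball.
Qed.

Lemma ball_approx_saddle_value : approx_on (fun d n => (n <= d)%N)
  (fun d n => (card_ball R d n)%:R : R) (saddle_value R).
Proof.
split; [exists (expR 1)|exists (2 * expR 1)]; rewrite ?mulr_gt0 ?expR_gt0 //.
  by move=> d n d0 n0 nd; rewrite card_ballE delannoy_le_saddle_value.
by move=> d n d0 n0 nd; rewrite card_ballE saddle_value_le_delannoy.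
Qed.

End Approx.

(** * Real power series on (-1, 1) *)

Section PowerSeries.
Variable R : realType.
Implicit Types (f g : nat -> R) (t : R).

(** This growth covers two formal differentiations of a series with coefficients bounded by 1, and
    still allows convergence for |t| < 1. *)
Definition quad_bounded f := forall k, `|f k| <= k.+1%:R * k.+2%:R.

(** Each of the k + 1 terms of 1 + q + ... + q^k is at least q^k, and the sum times 1 - q is 1 -
    q^(k+1). *)
Lemma natr_mulX_le (q : R) k : 0 <= q <= 1 ->
  k.+1%:R * q ^+ k * (1 - q) <= 1 - q ^+ k.+1.
Proof.
move=> /andP[q0 q1]; elim: k => [|k IHk]; first by rewrite mul1r !mul1r.
have : 0 <= q ^+ k <= 1 by rewrite exprn_ge0 // exprn_ile1.
rewrite -[k.+2%:R]natr1 !exprS in IHk *.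
move: (q ^+ k) (k.+1%:R) IHk => u K IHk /andP[u0 u1].
have step : q * (K * u * (1 - q)) <= q * (1 - q * u) by rewrite ler_wpM2l.
have : 0 <= (1 - q) * (1 - q * u) by rewrite mulr_ge0 ?subr_ge0 ?mulr_ile1.
lra.
Qed.

Lemma is_cvg_pseries f t : quad_bounded f -> `|t| < 1 -> cvgn (pseries f t).
Proof.
move=> fq t1; have t0 := normr_ge0 t.
(* By Bernoulli's inequality q^3 >= 1 - 3 (1 - |t|) / 4 >= |t|. Two of the three factors q^k absorb
   the quadratic growth; the third is the geometric majorant. *)
pose q := 1 - (1 - `|t|) / 4.
have q0 : 0 < q by rewrite /q; lra.
have q1 : q < 1 by rewrite /q; lra.
have tq : `|t| <= q ^+ 3.
  have : 0 <= (1 - `|t|) ^+ 2 * (11 + `|t|) by rewrite mulr_ge0 ?sqr_ge0 //; lra.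
  by rewrite /q; lra.
pose M := 2 * (1 - q)^-1 ^+ 2.
have q1' : 0 < 1 - q by rewrite subr_gt0.
have M0 : 0 <= M by rewrite mulr_ge0 ?sqr_ge0.
apply: normed_cvg; apply: (@series_le_cvg _ _ (geometric M q)) => /=.
- by [].
- by move=> k; rewrite mulr_ge0 // exprn_ge0 // ltW.
- move=> k; rewrite normrM normrX.
  apply: le_trans (_ : k.+1%:R * k.+2%:R * (q ^+ 3) ^+ k <= _).
    by rewrite ler_pM ?fq ?exprn_ge0 // lerXn2r ?nnegrE ?exprn_ge0 // ltW.
  have kq : k.+1%:R * q ^+ k <= (1 - q)^-1.
    rewrite -[leRHS]mul1r ler_pdivlMr //; apply: le_trans (natr_mulX_le _ _) _.
      by rewrite !ltW.
    by rewrite gerBl exprn_ge0 // ltW.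
  have kq0 : 0 <= k.+1%:R * q ^+ k by rewrite mulr_ge0 ?exprn_ge0 // ltW.
  have k2 : k.+2%:R <= 2 * k.+1%:R :> R by rewrite -natrM ler_nat; lia.
  have qk0 : 0 <= q ^+ k by rewrite exprn_ge0 // ltW.
  rewrite -exprM mulnC exprM.
  apply: le_trans (_ : 2 * (k.+1%:R * q ^+ k) ^+ 2 * q ^+ k <= _).
    have -> : 2 * (k.+1%:R * q ^+ k) ^+ 2 * q ^+ k =
      k.+1%:R * (2 * k.+1%:R) * q ^+ k ^+ 3 :> R by ring.
    by apply: ler_wpM2r; [exact: exprn_ge0|exact: ler_wpM2l].
  apply: ler_wpM2r => //; apply: ler_wpM2l => //.
  by rewrite lerXn2r ?nnegrE ?invr_ge0 // ltW.
- by apply: is_cvg_geometric_series; rewrite ger0_norm ?ltW.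
Qed.

Definition psum f t : R := limn (pseries f t).

Lemma cvg_psum f t : quad_bounded f -> `|t| < 1 ->
  pseries f t @ \oo --> psum f t.
Proof. exact: is_cvg_pseries. Qed.

Lemma psum_linear f g (a b : R) t : quad_bounded f -> quad_bounded g -> `|t| < 1 ->
  psum (fun k => a * f k + b * g k) t = a * psum f t + b * psum g t.
Proof.
move=> fq gq t1; apply: cvg_lim => //.
have -> : pseries (fun k => a * f k + b * g k) t =
    (fun n => a * pseries f t n + b * pseries g t n).
  apply/funext => n; rewrite /pseries /series /= !mulr_sumr -big_split /=.
  by apply: eq_bigr => k _; ring.
by apply: cvgD; apply: cvgM; (exact: cvg_cst || exact: cvg_psum).
Qed.

Lemma psum_shift f t : quad_bounded f -> quad_bounded (fun k => f k.+1) ->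
  `|t| < 1 -> t * psum (fun k => f k.+1) t = psum f t - f 0%N.
Proof.
move=> fq fSq t1; apply/esym/eqP; rewrite subr_eq; apply/eqP.
apply: cvg_lim => //; rewrite -cvg_shiftS /=.
have -> : (fun n => pseries f t n.+1) =
    (fun n => t * pseries (fun k => f k.+1) t n + f 0%N).
  apply/funext => n; rewrite /pseries /series /= big_nat_recl //= expr0 mulr1.
  rewrite addrC mulr_sumr; congr (_ + _).
  by apply: eq_bigr => k _; rewrite exprS; ring.
apply: cvgD; last exact: cvg_cst.
by apply: cvgM; [exact: cvg_cst|exact: cvg_psum].
Qed.

Lemma psum0 f : quad_bounded f -> quad_bounded (fun k => f k.+1) ->
  psum f 0 = f 0%N.
Proof.
move=> fq fSq; have := psum_shift fq fSq (t := 0).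
by rewrite mul0r normr0 => /(_ ltr01)/esym/eqP; rewrite subr_eq0 => /eqP.
Qed.

Lemma is_derive_psum f t :
  quad_bounded f -> quad_bounded (pseries_diffs f) ->
  quad_bounded (pseries_diffs (pseries_diffs f)) -> `|t| < 1 ->
  is_derive t (1 : R) (psum f) (psum (pseries_diffs f) t).
Proof.
move=> fq dq ddq t1; have t0 := normr_ge0 t.
(* The radius (1 + |t|) / 2 lies strictly between |t| and 1. *)
have K1 : `|(1 + `|t|) / 2| < 1 by rewrite ger0_norm; lra.
apply: (@pseries_snd_diffs _ _ ((1 + `|t|) / 2)); try exact: is_cvg_pseries.
by rewrite [ltRHS]ger0_norm; lra.
Qed.

End PowerSeries.

(** * The expansion of the phase at 0 *)

Section PhaseSeries.
Variable R : realType.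

(** The Taylor coefficients of (1 + t)^(-1/2), through their consecutive quotients. *)
Fixpoint invsqrt_coef (k : nat) : R :=
  if k is k'.+1 then - ((2 * k'%:R + 1) / (2 * k'.+1%:R)) * invsqrt_coef k'
  else 1.

(* The inverse of [0] is [0], hence [phase_coef 0 = 0]. *)
Definition phase_coef (k : nat) : R :=
  - invsqrt_coef k / (2 * k%:R * (2 * k%:R + 1)).

Lemma phase_coef0 : phase_coef 0 = 0.
Proof. by rewrite /phase_coef mulr0 mul0r invr0 mulr0. Qed.

(** The coefficient form of 2 (1 + t) C' = - C, the equation of C = (1 + t)^(-1/2). *)
Lemma invsqrt_coefS k :
  2 * (k.+1%:R * invsqrt_coef k.+1) = - (2 * k%:R + 1) * invsqrt_coef k.
Proof. by rewrite /=; field; rewrite addrC natr1 pnatr_eq0. Qed.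

Lemma invsqrt_coef_le1 k : `|invsqrt_coef k| <= 1.
Proof.
elim: k => [|k IHk]; first by rewrite normr1.
rewrite normrM normrN -[leRHS]mul1r ler_pM //.
rewrite ger0_norm ?divr_ge0 ?addr_ge0 ?mulr_ge0 //.
by rewrite ler_pdivrMr ?mulr_gt0 // -[k.+1%:R]natr1; lra.
Qed.

(** This decay keeps the coefficients bounded by 1 after two differentiations, and later compensates
    the factor m^2 in [pow_taylor1]. *)
Lemma phase_coef_le k : (2 * k%:R) ^+ 2 * `|phase_coef k| <= 1.
Proof.
have k0 : 0 <= k%:R :> R by [].
rewrite /phase_coef normrM normrN normfV.
case: k k0 => [|k] k0; first by rewrite mulr0 expr0n mul0r.
have k1 : 0 < k.+1%:R :> R by [].
rewrite (@gtr0_norm _ (2 * _ * _)); last by rewrite !mulr_gt0 //; lra.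
apply: le_trans (_ : (2 * k.+1%:R) ^+ 2 *
    (1 / (2 * k.+1%:R * (2 * k.+1%:R + 1))) <= _).
  apply: ler_wpM2l; first exact: sqr_ge0.
  apply: ler_wpM2r; last exact: invsqrt_coef_le1.
  by rewrite invr_ge0 !mulr_ge0 //; lra.
rewrite mulrA mulr1 ler_pdivrMr; last by rewrite !mulr_gt0 //; lra.
nra.
Qed.

Lemma quad_bounded_le1 (f : nat -> R) :
  (forall k, `|f k| <= 1) -> quad_bounded f.
Proof.
move=> f1 k; apply: le_trans (f1 k) _.
by rewrite -natrM -[leLHS]/(1%:R) ler_nat.
Qed.

Let c := invsqrt_coef.
Let b := phase_coef.

Let cq : quad_bounded c. Proof. exact/quad_bounded_le1/invsqrt_coef_le1. Qed.

Let cSq : quad_bounded (fun k => c k.+1).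
Proof. by apply: quad_bounded_le1 => k; exact: invsqrt_coef_le1. Qed.

Let kcq : quad_bounded (fun k => k%:R * c k).
Proof.
move=> k; rewrite normrM normr_nat ler_pM // ?ler_nat //.
by apply: le_trans (invsqrt_coef_le1 k) _; rewrite -[leLHS]/(1%:R) ler_nat.
Qed.

Let dcq : quad_bounded (pseries_diffs c).
Proof.
move=> k; rewrite /pseries_diffs normrM normr_nat ler_pM //.
by apply: le_trans (invsqrt_coef_le1 _) _; rewrite -[leLHS]/(1%:R) ler_nat.
Qed.

Let ddcq : quad_bounded (pseries_diffs (pseries_diffs c)).
Proof.
move=> k; rewrite /pseries_diffs 2!normrM !normr_nat.
rewrite mulrA -[leRHS]mulr1; apply: ler_pM => //; exact: invsqrt_coef_le1.
Qed.

Let b1 k (m : R) : 0 <= m -> m <= (2 * k%:R) ^+ 2 -> `|m * b k| <= 1.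
Proof.
move=> m0 mk; rewrite normrM (ger0_norm m0).
by apply: le_trans (phase_coef_le k); rewrite ler_wpM2r.
Qed.

Let bq : quad_bounded b.
Proof.
apply: quad_bounded_le1 => -[|k].
  by rewrite /b phase_coef0 normr0.
rewrite -[b _]mul1r; apply: b1 => //.
by rewrite -natrM -natrX -[leLHS]/(1%:R) ler_nat; lia.
Qed.

Let bSq : quad_bounded (fun k => b k.+1).
Proof.
apply: quad_bounded_le1 => k; rewrite -[b _]mul1r; apply: b1 => //.
by rewrite -natrM -natrX -[leLHS]/(1%:R) ler_nat; lia.
Qed.

Let dbq : quad_bounded (pseries_diffs b).
Proof.
apply: quad_bounded_le1 => k; apply: b1 => //.
by rewrite -natrM -natrX ler_nat; nia.
Qed.

Let kdbq : quad_bounded (fun k => k%:R * pseries_diffs b k).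
Proof.
apply: quad_bounded_le1 => k; rewrite /pseries_diffs mulrA; apply: b1 => //.
by rewrite -!natrM -natrX ler_nat; nia.
Qed.

Let ddbq : quad_bounded (pseries_diffs (pseries_diffs b)).
Proof.
apply: quad_bounded_le1 => k; rewrite /pseries_diffs mulrA; apply: b1 => //.
by rewrite -!natrM -natrX ler_nat; nia.
Qed.

Let dddbq : quad_bounded (pseries_diffs (pseries_diffs (pseries_diffs b))).
Proof.
move=> k; rewrite /pseries_diffs normrM normr_nat ler_pM // mulrA.
apply: le_trans (b1 _ _) _ => //; first by rewrite -!natrM -natrX ler_nat; nia.
by rewrite -[leLHS]/(1%:R) ler_nat.
Qed.

Lemma psum_invsqrt_ode (t : R) : `|t| < 1 ->
  2 * (1 + t) * psum (pseries_diffs c) t = - psum c t.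
Proof.
move=> t1.
have E1 : t * psum (pseries_diffs c) t = psum (fun k => k%:R * c k) t.
  by have := psum_shift kcq dcq t1; rewrite mul0r subr0.
have E2 : 2 * psum (pseries_diffs c) t =
    - 2 * psum (fun k => k%:R * c k) t + (- 1) * psum c t.
  rewrite -psum_linear // -[2 * psum _ t]addr0 -[0](mul0r (psum c t)) -psum_linear //.
  congr (psum _ t); apply/funext => k; rewrite mul0r addr0 /pseries_diffs.
  by rewrite invsqrt_coefS; rewrite /c; ring.
have -> : 2 * (1 + t) * psum (pseries_diffs c) t =
  2 * psum (pseries_diffs c) t + 2 * (t * psum (pseries_diffs c) t) by ring.
by rewrite E2 E1; ring.
Qed.

Lemma is_derive_comp_sqr (f : R -> R) (x a : R) :
  is_derive (x * x) 1 f a ->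
  is_derive x (1 : R) (fun y => f (y * y)) (a * (2 * x)).
Proof.
move=> fa; have D := is_derive_mul (is_derive_idfun x) (is_derive_idfun x).
apply: is_derive_eq (@is_derive1_comp R f (fun y => y * y) x _ _ fa D) _.
by ring.
Qed.

Let sqr_lt1 (x : R) : 0 <= x -> x < 1 -> `|x * x| < 1.
Proof. by move=> x0 x1; rewrite ger0_norm ?mulr_ge0 //; nra. Qed.

(** With C the sum of the series, C(y^2) [hyp y] is 1 at 0 and has zero derivative by the
    differential equation. *)
Lemma psum_invsqrt (x : R) : 0 <= x -> x < 1 -> psum c (x * x) * hyp x = 1.
Proof.
move=> x0 x1.
have [y /andP[y0 yx]|z _] := @MVT_is_derive R
    (fun y => psum c (y * y) * hyp y) (fun=> 0) 0 x x0.
  have y1 := sqr_lt1 y0 (le_lt_trans yx x1).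
  apply: is_derive_eq.
    exact: is_derive_mul (is_derive_comp_sqr (is_derive_psum cq dcq ddcq y1))
      (is_derive_hyp y).
  have h0 := hyp_gt0 y.
  rewrite -[psum c _]opprK -psum_invsqrt_ode // -expr2 -hyp_sqr.
  by field; rewrite gt_eqF.
move=> /= /eqP; rewrite [X in _ == X]mul0r subr_eq0 => /eqP ->.
by rewrite mulr0 psum0 // mul1r /hyp expr0n addr0 sqrtr1.
Qed.

(** With t = x^2 and B the sum of the series, the left side is x times the second derivative of x
    B(x^2). On coefficients, 6 (k + 1) + 4 k (k + 1) = 2 (k + 1) (2 k + 3) cancels the denominator
    of b_(k+1). *)
Lemma psum_phase_ode (t : R) : `|t| < 1 ->
  t * (6 * psum (pseries_diffs b) t +
       4 * t * psum (pseries_diffs (pseries_diffs b)) t) = 1 - psum c t.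
Proof.
move=> t1.
have E1 : t * psum (pseries_diffs (pseries_diffs b)) t =
    psum (fun k => k%:R * pseries_diffs b k) t.
  by have := psum_shift kdbq ddbq t1; rewrite mul0r subr0.
rewrite -[4 * t * _]mulrA E1 -psum_linear //.
have -> : (fun k => 6 * pseries_diffs b k + 4 * (k%:R * pseries_diffs b k)) =
    (fun k => - 1 * c k.+1 + 0 * c k).
  apply/funext => k; rewrite mul0r addr0 /pseries_diffs /b /phase_coef -/(c k.+1).
  have k0 : 0 <= k%:R :> R by [].
  rewrite -[k.+1%:R]natr1; field.
  by apply/andP; split; apply/eqP; lra.
rewrite psum_linear // mul0r addr0 mulrCA psum_shift //.
by rewrite [c 0%N]/=; ring.
Qed.

(** Both sides vanish at 0 with their first derivatives and have the same second derivative y / (h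
    (1 + h)), h = [hyp y]; two integrations conclude. *)
Lemma phase_psum (x : R) : 0 <= x -> x < 1 -> phase x = x * psum b (x * x).
Proof.
move=> x0 x1.
have Db (y : R) : 0 <= y -> y < 1 -> is_derive y (1 : R)
    (fun y => psum b (y * y)) (psum (pseries_diffs b) (y * y) * (2 * y)).
  by move=> y0 y1; apply: is_derive_comp_sqr; apply: is_derive_psum; rewrite ?sqr_lt1.
(* [U] is the derivative of the right side. *)
pose U y := psum b (y * y) + y * (psum (pseries_diffs b) (y * y) * (2 * y)).
have DU (y : R) : 0 <= y -> y < 1 -> is_derive y (1 : R) U (y / (hyp y * (1 + hyp y))).
  move=> y0 y1; have yy1 := sqr_lt1 y0 y1.
  have Ddb := is_derive_comp_sqr (is_derive_psum dbq ddbq dddbq yy1).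
  have D2 := is_derive_mul (is_derive_const 2 y) (is_derive_idfun y).
  apply: is_derive_eq.
    exact: is_derive_add (Db y y0 y1)
      (is_derive_mul (is_derive_idfun y) (is_derive_mul Ddb D2)).
  (* At 0 both values are 0; elsewhere the goal is multiplied by y to match the differential
     equation. *)
  have [->|yn0] := eqVneq y 0; first by rewrite !(mul0r, mulr0, addr0).
  have := psum_phase_ode yy1; have := psum_invsqrt y0 y1.
  move=> CE ode.
  have h0 := hyp_gt0 y; have hy := hyp_sqr y.
  have {}CE : psum c (y * y) = (hyp y)^-1 by rewrite -[RHS]mul1r -CE mulfK // gt_eqF.
  apply: (mulfI yn0); rewrite [RHS]mulrA.
  rewrite [X in _ = X / _](_ : _ = (hyp y - 1) * (1 + hyp y)); last first.
    by rewrite -expr2; ring: hy.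
  have -> : (hyp y - 1) * (1 + hyp y) / (hyp y * (1 + hyp y)) = 1 - (hyp y)^-1.
    by field; rewrite !gt_eqF ?addr_gt0.
  by rewrite -CE -ode; ring.
have b0 : b 0%N = 0 by exact: phase_coef0.
(* First integration; the values at 0 agree because b_0 = 0. *)
have UE (y : R) : 0 <= y -> y < 1 -> U y = ln ((1 + hyp y) / 2).
  move=> y0 y1.
  have [z /andP[z0 zy]|z _] := @MVT_is_derive R
      (fun y => U y - ln ((1 + hyp y) / 2)) (fun=> 0) 0 y y0.
    have D := DU z z0 (le_lt_trans zy y1).
    by apply: is_derive_eq (is_derive_sub D (is_derive_ln_hyp z)) _; rewrite subrr.
  rewrite /= [X in _ = X]mul0r => /eqP; rewrite subr_eq0 => /eqP.
  have -> : U 0 - ln ((1 + hyp 0) / 2) = 0.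
    by rewrite /U !mul0r addr0 psum0 // b0 /hyp expr0n addr0 sqrtr1 divff // ln1 subr0.
  by move/eqP; rewrite subr_eq0 => /eqP.
(* Second integration, starting from [phase 0 = 0]. *)
have [y /andP[y0 yx]|z _] := @MVT_is_derive R
    (fun y => phase y - y * psum b (y * y)) (fun=> 0) 0 x x0.
  have y1 := le_lt_trans yx x1.
  apply: is_derive_eq (is_derive_sub (is_derive_phase y)
    (is_derive_mul (is_derive_idfun y) (Db y y0 y1))) _.
  by rewrite -UE // mul1r /U subrr.
rewrite /= [X in _ = X]mul0r => /eqP; rewrite subr_eq0 => /eqP.
rewrite phase0 mul0r subr0 => /eqP; rewrite subr_eq0 => /eqP.
by [].
Qed.

End PhaseSeries.

(** * Complex series with geometric majorants *)

Section ComplexSeries.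
Variable R : realType.
Implicit Types (z w h : R[i]) (u v : nat -> R[i]).

Lemma geometric_tail (a : nat -> R) (M q : R) : 0 <= q < 1 ->
  (forall k, `|a k| <= M * q ^+ k) ->
  cvgn (series a) /\
  forall N, `|limn (series a) - series a N| <= M / (1 - q) * q ^+ N.
Proof.
move=> /andP[q0 q1] aM.
have M0 : 0 <= M by have := aM 0%N; rewrite expr0 mulr1; apply: le_trans.
have cvga : cvgn (series a).
  apply: normed_cvg; apply: (@series_le_cvg _ _ (geometric M q)) => //=.
    by move=> k; rewrite mulr_ge0 ?exprn_ge0.
  by apply: is_cvg_geometric_series; rewrite ger0_norm.
split=> // N.
(* Keeping q^N - q^(N+j) makes the induction on j exact; q^(N+j) is dropped afterwards. *)
have tail j : `|series a (N + j)%N - series a N| <= M / (1 - q) * (q ^+ N - q ^+ (N + j)).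
  elim: j => [|j IHj]; first by rewrite addn0 !subrr normr0 mulr0.
  rewrite addnS /series /= big_nat_recr //= -/(series a (N + j)%N) addrAC.
  apply: le_trans (ler_normD _ _) _.
  apply: le_trans (lerD IHj (aM _)) _.
  rewrite le_eqVlt; apply/orP; left; apply/eqP; rewrite exprS; field.
  by rewrite subr_eq0 gt_eqF.
have bound m : (N <= m)%N -> `|series a m - series a N| <= M / (1 - q) * q ^+ N.
  move=> Nm; rewrite -(subnKC Nm); apply: le_trans (tail _) _.
  apply: ler_wpM2l; first by rewrite divr_ge0 // subr_ge0 ltW.
  by rewrite gerBl exprn_ge0.
rewrite ler_distl; apply/andP; split.
  apply: limr_ge => //; near=> m.
  by have := bound m; rewrite ler_distl => /(_ _)/andP[] //; near: m;
    exact: nbhs_infty_ge.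
apply: limr_le => //; near=> m.
by have := bound m; rewrite ler_distl => /(_ _)/andP[] //; near: m;
  exact: nbhs_infty_ge.
Unshelve. all: by end_near. Qed.

Lemma normCE z : `|z| = (normc z)%:C.
Proof. by []. Qed.

Lemma normc_ge0 z : 0 <= normc z.
Proof. by case: z => x y; exact: sqrtr_ge0. Qed.

Lemma normcX z n : normc (z ^+ n) = normc z ^+ n.
Proof. by elim: n => [|n IHn]; rewrite ?expr0 ?normc1 // !exprS normcM IHn. Qed.

Lemma normc_real (x : R) : normc x%:C = `|x|.
Proof. by rewrite /normc /= expr0n addr0 sqrtr_sqr. Qed.

Lemma normc_natr n : normc (n%:R : R[i]) = n%:R.
Proof. by rewrite -(rmorph_nat (real_complex R)) normc_real normr_nat. Qed.

Lemma Re_le_normc z : `|complex.Re z| <= normc z.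
Proof. by rewrite -lecR normc_ge_Re. Qed.

Lemma Im_le_normc z : `|complex.Im z| <= normc z.
Proof.
case: z => x y; rewrite /normc /= -[leLHS]ger0_norm // -sqrtr_sqr.
by apply: ler_wsqrtr; rewrite real_normK ?num_real // lerDr sqr_ge0.
Qed.

Lemma normc_le_ReIm z : normc z <= `|complex.Re z| + `|complex.Im z|.
Proof.
rewrite [in leLHS](complexE z); apply: le_trans (le_normcD _ _) _.
rewrite normcM !normc_real lerD2l -[leRHS]mul1r ler_wpM2r //.
by rewrite /normc /= expr0n expr1n add0r sqrtr1.
Qed.

(* The sum of a series is built coordinatewise, from the completeness of [R]. *)
Definition csum u : R[i] :=
  limn (series (fun k => complex.Re (u k))) +i*
  limn (series (fun k => complex.Im (u k))).

Definition geometric_bounded u := exists (M q : R), 0 <= q < 1 /\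
  forall k, normc (u k) <= M * q ^+ k.

(** The factor 2 comes from adding the tails of the real and imaginary parts. *)
Lemma csum_tail u (M q : R) : 0 <= q < 1 ->
  (forall k, normc (u k) <= M * q ^+ k) ->
  forall N, normc (csum u - \sum_(0 <= k < N) u k) <= 2 * (M / (1 - q) * q ^+ N).
Proof.
move=> q01 uM N.
have [_ /(_ N) re] := geometric_tail q01 (fun k => le_trans (Re_le_normc (u k)) (uM k)).
have [_ /(_ N) im] := geometric_tail q01 (fun k => le_trans (Im_le_normc (u k)) (uM k)).
apply: le_trans (normc_le_ReIm _) _; rewrite mulr_natl mulr2n lerD //.
  by rewrite raddfB raddf_sum.
by rewrite raddfB raddf_sum.
Qed.

Lemma cvg_csum u : geometric_bounded u ->
  (fun N => \sum_(0 <= k < N) u k : R[i]^o) @ \oo --> (csum u : R[i]^o).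
Proof.
move=> [M [q [q01 uM]]]; have tail := csum_tail q01 uM.
have [q0 q1] := andP q01.
have cvg0 : (fun N => 2 * (M / (1 - q) * q ^+ N)) @ \oo --> (0 : R).
  rewrite -[0](mulr0 2); apply: cvgM; first exact: cvg_cst.
  rewrite -[0](mulr0 (M / (1 - q))); apply: cvgM; first exact: cvg_cst.
  by apply: cvg_expr; rewrite ger0_norm.
apply/cvgrPdist_lt => e e0.
(* A positive element of [R[i]] is real, so the tolerance is a positive real number. *)
have eE : e = (complex.Re e)%:C by rewrite RRe_real // gtr0_real.
rewrite eE ltcR in e0.
move/cvgrPdist_lt : cvg0 => /(_ _ e0); apply: filterS => N.
rewrite sub0r normrN eE => lt_e.
rewrite normCE ltcR; apply: le_lt_trans (tail N) _.
exact: le_lt_trans (ler_norm _) lt_e.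
Qed.

Lemma csum_unique u (l : R[i]) : geometric_bounded u ->
  (fun N => \sum_(0 <= k < N) u k : R[i]^o) @ \oo --> (l : R[i]^o) -> csum u = l.
Proof.
by move=> ub ul; apply: (cvg_unique _ (cvg_csum ub) ul); exact: norm_hausdorff.
Qed.

End ComplexSeries.

(** * Complex differentiability of the sum of the series *)

Section Holomorphy.
Variable R : realType.
Implicit Types (z w h : R[i]) (u v : nat -> R[i]).

Lemma geometric_bounded_linear u v (a : R[i]) (M M' q : R) :
  (forall k, normc (u k) <= M * q ^+ k) ->
  (forall k, normc (v k) <= M' * q ^+ k) ->
  forall k, normc (u k - a * v k) <= (M + normc a * M') * q ^+ k.
Proof.
move=> uM vM k; apply: le_trans (le_normcD _ _) _.
rewrite normcN normcM mulrDl lerD // -mulrA ler_wpM2l ?normc_ge0 //.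
Qed.

Lemma csum_linear u v (a : R[i]) (M M' q : R) : 0 <= q < 1 ->
  (forall k, normc (u k) <= M * q ^+ k) ->
  (forall k, normc (v k) <= M' * q ^+ k) ->
  csum (fun k => u k - a * v k) = csum u - a * csum v.
Proof.
move=> q01 uM vM; apply: csum_unique.
  exists (M + normc a * M'), q; split=> //.
  exact: geometric_bounded_linear.
have -> : (fun N => \sum_(0 <= k < N) (u k - a * v k) : R[i]^o) =
    (fun N => (\sum_(0 <= k < N) u k : R[i]^o) - a *: (\sum_(0 <= k < N) v k : R[i]^o)).
  by apply/funext => N; rewrite sumrB /GRing.scale /= mulr_sumr.
apply: cvgB; first by apply: cvg_csum; exists M, q.
by apply: cvgZr; apply: cvg_csum; exists M', q.
Qed.

(** The remainder at m + 1 is z + h times the remainder at m, plus m h^2 z^(m-1), and m^2 + m <= (m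
    + 1)^2. The factor r^2 on the left avoids the exponent m - 2. *)
Lemma pow_taylor1 z h (r : R) m : normc z <= r -> normc (z + h) <= r ->
  r ^+ 2 * normc ((z + h) ^+ m - z ^+ m - m%:R * h * z ^+ m.-1) <=
  m%:R ^+ 2 * r ^+ m * normc h ^+ 2.
Proof.
move=> zr zhr; have r0 : 0 <= r := le_trans (normc_ge0 z) zr.
elim: m => [|m IHm].
  by rewrite !expr0 !mul0r subrr subr0 normc0 mulr0 expr0n !mul0r.
have -> : (z + h) ^+ m.+1 - z ^+ m.+1 - m.+1%:R * h * z ^+ m =
    (z + h) * ((z + h) ^+ m - z ^+ m - m%:R * h * z ^+ m.-1) +
    m%:R * h ^+ 2 * z ^+ m.-1.
  case: m {IHm} => [|m] /=; rewrite ?expr0 ?expr1; first by ring.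
  by rewrite -[_.+2%:R]natr1 -[_.+1%:R]natr1 !exprS; ring.
apply: le_trans (ler_wpM2l _ (le_normcD _ _)) _; first exact: sqr_ge0.
rewrite mulrDr !normcM normc_natr !normcX -[normc h * normc h]expr2.
have last_le : r ^+ 2 * (m%:R * normc h ^+ 2 * normc z ^+ m.-1) <=
    m%:R * (r ^+ m.+1 * normc h ^+ 2).
  case: m {IHm} => [|m] /=; first by rewrite !mul0r mulr0.
  have -> : r ^+ 2 * (m.+1%:R * normc h ^+ 2 * normc z ^+ m) =
    m.+1%:R * (r ^+ 2 * normc z ^+ m * normc h ^+ 2) by ring.
  apply: ler_wpM2l => //; apply: ler_wpM2r; first exact: sqr_ge0.
  rewrite -[m.+2]add2n exprD; apply: ler_wpM2l; first exact: sqr_ge0.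
  by rewrite lerXn2r // nnegrE // normc_ge0.
have first_le : r ^+ 2 * (normc (z + h) *
      normc ((z + h) ^+ m - z ^+ m - m%:R * h * z ^+ m.-1)) <=
    r * (m%:R ^+ 2 * r ^+ m * normc h ^+ 2).
  rewrite mulrCA; apply: le_trans (ler_wpM2l (normc_ge0 _) IHm) _.
  apply: ler_wpM2r => //.
  by rewrite !mulr_ge0 ?exprn_ge0 ?normc_ge0.
apply: le_trans (lerD first_le last_le) _.
have -> : r * (m%:R ^+ 2 * r ^+ m * normc h ^+ 2) +
    m%:R * (r ^+ m.+1 * normc h ^+ 2) =
  (m%:R ^+ 2 + m%:R) * (r ^+ m.+1 * normc h ^+ 2) by rewrite [r ^+ m.+1]exprS; ring.
rewrite -[leRHS]mulrA; apply: ler_wpM2r.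
  by rewrite !mulr_ge0 ?exprn_ge0 ?normc_ge0.
by rewrite -natr1; have : 0 <= m%:R :> R by []; lra.
Qed.

Definition phase_term z (k : nat) : R[i] := (phase_coef R k)%:C * z ^+ (2 * k).

Definition phase_fun z : R[i] := csum (phase_term z).

Let b k : R := phase_coef R k.

Lemma phase_coef_bound k m : (m <= (2 * k) ^ 2)%N -> m%:R * `|b k| <= 1.
Proof.
move=> mk; apply: le_trans (phase_coef_le R k).
by apply: ler_wpM2r => //; rewrite -natrM -natrX ler_nat.
Qed.

Lemma phase_coef_le1 k : `|b k| <= 1.
Proof.
case: k => [|k]; first by rewrite /b phase_coef0 normr0.
by rewrite -[leLHS]mul1r -[1 * _]/(1%:R * _) phase_coef_bound // expn_gt0.
Qed.

Lemma phase_term_bound z (r : R) k : normc z <= r ->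
  normc (phase_term z k) <= 1 * (r ^+ 2) ^+ k.
Proof.
move=> zr; rewrite normcM normc_real normcX -exprM.
apply: ler_pM; rewrite ?exprn_ge0 ?normc_ge0 ?phase_coef_le1 //.
by rewrite lerXn2r // nnegrE ?normc_ge0 // (le_trans (normc_ge0 z)).
Qed.

(** The derivative of [phase_term]. At k = 0 the exponent is truncated to 0, but the factor 2 k
    vanishes. *)
Let dterm z (k : nat) : R[i] := (b k)%:C * ((2 * k)%:R * z ^+ (2 * k).-1).

Lemma phase_dterm_bound z (r : R) k : 0 < r -> normc z <= r ->
  normc (dterm z k) <= r^-1 * (r ^+ 2) ^+ k.
Proof.
move=> r0 zr; rewrite !normcM normc_real normc_natr normcX -exprM mulrA.
case: k => [|k]; first by rewrite mulr0 mul0r muln0 expr0 mulr1 invr_ge0 ltW.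
rewrite mulnS /= -[(2 + _)%N]/(2 * k).+2 [r ^+ _]exprS mulKf ?gt_eqF //.
rewrite -[leRHS]mul1r; apply: ler_pM; rewrite ?mulr_ge0 ?exprn_ge0 ?normc_ge0 //.
  by rewrite mulrC phase_coef_bound //; nia.
by rewrite lerXn2r // nnegrE ?normc_ge0 // ltW.
Qed.

(** Each term obeys [pow_taylor1] with m = 2 k; there (2 k)^2 |b_k| <= 1 removes m^2, and a
    geometric series in r^2 remains. *)
Lemma phase_fun_increment z h (r : R) : 0 < r < 1 ->
  normc z <= r -> normc (z + h) <= r ->
  normc (phase_fun (z + h) - phase_fun z - h * csum (dterm z)) <=
  2 * (r ^- 2 / (1 - r ^+ 2)) * normc h ^+ 2.
Proof.
move=> /andP[r0 r1] zr zhr.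
have q01 : 0 <= r ^+ 2 < 1 by rewrite sqr_ge0 expr_lt1 // ltW.
have B0 k := phase_term_bound k zr; have B1 k := phase_term_bound k zhr.
have B2 k := phase_dterm_bound k r0 zr.
rewrite /phase_fun -[csum (phase_term z)]mul1r.
rewrite -(csum_linear 1 q01 B1 B0).
rewrite -(csum_linear h q01 (geometric_bounded_linear 1 B1 B0) B2).
set w := (fun k => _).
have wM k : normc (w k) <= (r ^- 2 * normc h ^+ 2) * (r ^+ 2) ^+ k.
  have -> : w k = (b k)%:C *
      ((z + h) ^+ (2 * k) - z ^+ (2 * k) - (2 * k)%:R * h * z ^+ (2 * k).-1).
    by rewrite /w /phase_term /dterm; ring.
  rewrite normcM normc_real -exprM -[leRHS]mulrA ler_pdivlMl ?exprn_gt0 //.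
  rewrite mulrCA; apply: le_trans (ler_wpM2l _ (pow_taylor1 (2 * k) zr zhr)) _ => //.
  rewrite -[(2 * k)%:R ^+ 2 * _ * _]mulrA [leLHS]mulrA [leRHS]mulrC -[leRHS]mul1r.
  apply: ler_wpM2r.
    by rewrite !mulr_ge0 ?exprn_ge0 ?normc_ge0 // ltW.
  by rewrite mulrC -natrX phase_coef_bound.
have := csum_tail q01 wM 0; rewrite big_geq // subr0 expr0 mulr1.
move=> /le_trans; apply; rewrite le_eqVlt; apply/orP; left; apply/eqP.
by ring.
Qed.

Lemma phase_fun_derivable z : normc z < 1 ->
  derivable (phase_fun : R[i]^o -> R[i]^o) z 1.
Proof.
move=> z1; have z0 := normc_ge0 z.
pose r : R := (1 + normc z) / 2.
have r01 : 0 < r < 1 by apply/andP; rewrite /r; split; lra.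
have zr : normc z <= r by rewrite /r; lra.
pose K : R := 2 * (r ^- 2 / (1 - r ^+ 2)).
have [r0 r1] := andP r01.
have rr : 0 < 1 - r ^+ 2 by rewrite subr_gt0 expr_lt1 // ltW.
have K0 : 0 < K by rewrite !mulr_gt0 ?invr_gt0 ?exprn_gt0.
apply/cvg_ex; exists (csum (dterm z)); apply/cvgrPdist_lt => e e0.
have eE : e = (complex.Re e)%:C by rewrite RRe_real // gtr0_real.
rewrite eE ltcR in e0.
have near_lt (d : R) : 0 < d -> \forall h \near (0 : R[i]^o)^', normc h < d.
  move=> d0; have d0' : 0 < d%:C by rewrite ltcR.
  apply: filterS (dnbhs0_lt d0') => h.
  by rewrite normCE ltcR.
near=> h.
have h0 : h != 0 by near: h; exact: nbhs_dnbhs_neq.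
(* This keeps z + h in the disk of radius r; the next bound makes the error K |h| of the difference
   quotient smaller than the tolerance. *)
have h1 : normc h < r - normc z by near: h; apply: near_lt; rewrite /r; lra.
have h2 : normc h < complex.Re e / K by near: h; apply: near_lt; rewrite divr_gt0.
have nh0 : 0 < normc h.
  by rewrite lt_def normc_ge0 andbT; apply: contra h0 => /eqP/eq0_normc ->.
have zhr : normc (z + h) <= r by apply: le_trans (le_normcD _ _) _; lra.
rewrite eE normCE ltcR -normcN opprB.
have -> : h^-1 *: (phase_fun (h *: 1 + z) - phase_fun z) - csum (dterm z) =
    h^-1 * (phase_fun (z + h) - phase_fun z - h * csum (dterm z)).
  by rewrite /GRing.scale /= mulr1 [h + z]addrC [RHS]mulrBr mulKf.
rewrite normcM normcV -ltr_pdivlMl ?invr_gt0 // invrK.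
apply: le_lt_trans (phase_fun_increment r01 zr zhr) _.
by rewrite -/K expr2 mulrCA ltr_pM2l // -ltr_pdivlMl // mulrC.
Unshelve. all: by end_near. Qed.

Lemma cvg_phase_fun z : normc z < 1 ->
  (fun N => \sum_(0 <= k < N) phase_term z k : R[i]^o) @ \oo -->
  (phase_fun z : R[i]^o).
Proof.
move=> z1; apply: cvg_csum; exists 1, (normc z ^+ 2); split.
  by rewrite sqr_ge0 expr_lt1 // normc_ge0.
by move=> k; exact: phase_term_bound.
Qed.

Lemma phase_term_real (x : R) k :
  phase_term x%:C k = (b k * (x * x) ^+ k)%:C.
Proof.
rewrite /phase_term -expr2 -exprM (rmorphM (real_complex R) (b k)).
by rewrite (rmorphXn (real_complex R)).
Qed.

(** This ties the complex function to the real expansion of [phase]: [csum] takes the limit of the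
    real parts, which form the real series in x^2. *)
Lemma Re_phase_fun (x : R) :
  complex.Re (phase_fun x%:C) = psum (phase_coef R) (x * x).
Proof.
rewrite /phase_fun /csum /=; congr (limn (series _)).
by apply/funext => k; rewrite phase_term_real.
Qed.

Lemma Im_phase_fun (x : R) : complex.Im (phase_fun x%:C) = 0.
Proof.
rewrite /phase_fun /csum /=.
have -> : (fun k => complex.Im (phase_term x%:C k)) = (fun=> 0).
  by apply/funext => k; rewrite phase_term_real.
have -> : series (fun=> 0 : R) = (fun=> 0).
  by apply/funext => N; rewrite /series /= big1.
exact: lim_cst.
Qed.

End Holomorphy.

(** * The expansion of b, the exchange of d and n, and the theorem *)

Section Final.
Variable R : realType.

Lemma normc_lt1 (z : R[i]) : `|z| < 2 / 3 -> normc z < 1.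
Proof.
have -> : 2 / 3 = (2 / 3 : R)%:C.
  by rewrite (fmorph_div (real_complex R)) !(rmorph_nat (real_complex R)).
by rewrite normCE ltcR => /lt_trans; apply; lra.
Qed.

Lemma phase_coef1 : phase_coef R 1 = 12^-1.
Proof. by rewrite /phase_coef /=; field. Qed.

Lemma phase_coef2 : phase_coef R 2 = - 3 / 160.
Proof. by rewrite /phase_coef /=; field. Qed.

Lemma phase_fun_series (z : R[i]) : `|z| < 2 / 3 ->
  (fun N : nat => z ^+ 2 / 12 - 3 * z ^+ 4 / 160
     + \sum_(3 <= k < N) (phase_coef R k)%:C * z ^+ (2 * k) : R[i]^o)
  @ \oo --> (phase_fun z : R[i]^o).
Proof.
move=> /normc_lt1 z1; apply: cvg_trans (cvg_phase_fun z1).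
apply: near_eq_cvg; near=> N.
(* The terms k = 1 and k = 2 are always displayed and the term k = 0 is zero, so the partial sums
   agree as soon as N >= 3. *)
have N3 : (3 <= N)%N by near: N; exact: nbhs_infty_ge.
rewrite (@big_cat_nat _ _ _ 3 0 N) //= !big_nat_recr //= big_geq //.
rewrite /phase_term phase_coef0 phase_coef1 phase_coef2.
rewrite (fmorphV (real_complex R)) (fmorph_div (real_complex R)).
rewrite (rmorphN (real_complex R)) !(rmorph_nat (real_complex R)) rmorph0.
by congr (_ + _); ring.
Unshelve. all: by end_near. Qed.

(** For x = n / d <= 1/2, [phase_psum] gives d [phase x] = d x b(x), and d x = n. *)
Lemma phase_alpha d n : (0 < d)%N -> (2 * n <= d)%N ->
  d%:R * phase (alpha R d n) =
  n%:R * complex.Re (phase_fun (alpha R d n)%:C).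
Proof.
move=> d0 nd; have a0 : 0 < d%:R :> R by rewrite ltr0n.
have dx : d%:R * alpha R d n = n%:R by rewrite mulrC divfK // gt_eqF.
rewrite Re_phase_fun phase_psum ?divr_ge0 //.
  by rewrite mulrA dx.
rewrite /alpha ltr_pdivrMr // mul1r ltr_nat; lia.
Qed.

(** The symmetry D(d, n) = D(n, d) exchanges the roles of d and n. *)
Lemma ball_approx_saddle_value_swap : approx_on (fun d n => (d <= n)%N)
  (fun d n => (card_ball R d n)%:R : R) (fun d n => saddle_value R n d).
Proof.
have [[c c0 BV] [c' c'0 VB]] := ball_approx_saddle_value R.
split; [exists c|exists c'] => // d n d0 n0 dn.
  by rewrite card_ballE delannoyC -(card_ballE R) BV.
by rewrite card_ballE delannoyC -(card_ballE R) VB.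
Qed.

End Final.

Theorem theorem1p4 (R : realType) :
  let B d n : R := (card_ball R d n)%:R in
  let S d n : R := (card_sphere R d n)%:R in
  let D d n : R := (Delannoy d n)%:R in
  let e : R := expR 1 in
  [/\ forall d n : nat, (0 < d)%N -> (0 < n)%N -> (n <= d)%N ->
        Delannoy d n = card_ball R d n,
      approx_on (fun d n => (n <= d)%N) B S,
      approx_on (fun d n => (n <= d)%N) S
        (fun d n => let r := rho R d n in
           ((1 + r) / (1 - r)) ^+ d * r ^- n * (Num.sqrt n%:R)^-1),
      approx_on (fun d n => (n <= d)%N) D
        (fun d n => let s : R := Num.sqrt (d%:R ^+ 2 + n%:R ^+ 2) in
           (d%:R / (s - n%:R)) ^+ d * (n%:R / (s - d%:R)) ^+ n
             * (Num.sqrt n%:R)^-1)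
    & exists (b : R[i] -> R[i]) (bk : nat -> R),
      [/\ [/\ holomorphic_on [set z : R[i] | `|z| < 2 / 3] b,
              forall z : R[i], `|z| < 2 / 3 ->
                (fun N : nat => z ^+ 2 / 12 - 3 * z ^+ 4 / 160
                   + \sum_(3 <= k < N) (bk k)%:C * z ^+ (2 * k) : R[i]^o)
                  @ \oo --> (b z : R[i]^o)
            & forall x : R, `|x| < 2 / 3 -> complex.Im (b x%:C) = 0],
          approx_on (fun d n => (2 * n <= d)%N) B S,
          approx_on (fun d n => (2 * n <= d)%N) S
            (fun d n => (2 * e / alpha R d n) ^+ n * (Num.sqrt n%:R)^-1
               * expR (n%:R * complex.Re (b (alpha R d n)%:C)))
        & approx_on (fun d n => (2 * d <= n)%N) B
            (fun d n => (2 * e * alpha R d n) ^+ d * (Num.sqrt d%:R)^-1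
               * expR (d%:R * complex.Re (b ((alpha R d n)^-1)%:C)))]].
Proof.
move=> B S D e.
have BS := ball_approx_sphere R.
have BV := ball_approx_saddle_value R.
(* The closed forms for n <= d follow from [BV] or [SV] by rewriting the main term. *)
have SV := approx_on_trans (approx_on_sym BS) BV.
have half d n : (2 * n <= d)%N -> (n <= d)%N by lia.
split.
- by move=> d n _ _ _; exact: etrans (DelannoyE d n) (esym (card_ballE R d n)).
- exact: BS.
- by apply: approx_on_eqr SV => d n d0 n0 _; exact: saddle_value_rho.
- have -> : D = fun d n => (card_ball R d n)%:R.
    by apply/funext => d; apply/funext => n; rewrite /D DelannoyE card_ballE.
  by apply: approx_on_eqr BV => d n d0 n0 _; exact: saddle_value_sqrt.
exists (@phase_fun R), (phase_coef R); split.
- split.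
  + by move=> z /normc_lt1; exact: phase_fun_derivable.
  + exact: phase_fun_series.
  + by move=> x _; exact: Im_phase_fun.
- exact: approx_on_sub half BS.
- apply: approx_on_eqr (approx_on_sub half SV) => d n d0 n0 nd.
  by rewrite /saddle_value phase_alpha.
- have half' d n : (2 * d <= n)%N -> (d <= n)%N by lia.
  apply: approx_on_eqr (approx_on_sub half' (ball_approx_saddle_value_swap R)).
  move=> d n d0 n0 dn; rewrite /saddle_value (phase_alpha R n0 dn).
  (* With d and n exchanged, the expansion is taken at d / n <= 1/2. *)
  have -> : alpha R n d = (alpha R d n)^-1 by rewrite /alpha invf_div.
  by rewrite invrK.
Qed.
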